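(* Let $q$ be a prime power and let $G = \mathrm{SL}_3(q) \rtimes \langle t \rangle$, where $t$ acts upon $\mathrm{SL}_3(q)$ as the transpose inverse automorphism $A \mapsto (A^{T})^{-1}$. Assume that (i) $6 \mid q-1$; (ii) there exist $\lambda, \mu \in \mathrm{GF}(q)$ such that $2\lambda^2 = 1$ and $2\mu^2 - \lambda^2 = 0$; and (iii) at least one of the elements $-3^{-1}+(3^{-2}-1)^{1/2}$ and $-3^{-1}-(3^{-2}-1)^{1/2}$ of $\mathrm{GF}(q^2)$ has multiplicative order $q+1$ in $\mathrm{GF}(q^2)^*$. Then $G$ possesses an unravelled C-string of rank $4$ with Schläfli symbol $[4,q+1,4]$.
   Context: $\mathrm{GF}(q)$ is the finite field with $q$ elements, and $\mathrm{SL}_3(q)$ is the group of $3\times 3$ matrices of determinant $1$ over $\mathrm{GF}(q)$. In the semidirect product, $t$ is an element of order $2$. Here $(3^{-2}-1)^{1/2}$ denotes a square root of $3^{-2}-1$ in $\mathrm{GF}(q^2)$. C-strings. Let $G$ be a group and $\{t_1,\ldots,t_n\}$ a set of involutions (elements of order $2$) in $G$, indexed in the given order by $I=\{1,\ldots,n\}$. For $J\subseteq I$ put $G_J=\langle t_j \mid j\in J\rangle$, with $G_\emptyset=1$. The set $\{t_1,\ldots,t_n\}$ is a C-string for $G$ (of rank $n$) if: (a) $G=\langle t_1,\ldots,t_n\rangle$; (b) $t_i$ and $t_j$ commute whenever $|i-j|\ge 2$; (c) (intersection property) $G_J\cap G_K=G_{J\cap K}$ for all $J,K\subseteq I$. The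 Schläfli symbol of the C-string is the sequence $[\tau_{12},\tau_{23},\ldots,\tau_{n-1\,n}]$, where $\tau_{j\,j+1}$ is the order of $t_jt_{j+1}$. Unravelled C-strings. Let $G$ be a finite group with a C-string $\{t_1,\ldots,t_n\}$ of rank $n$. For $N\trianglelefteq G$, write $\overline{g}$ for the image of $g$ in $\overline{G}=G/N$. The C-string is called $N$-unravelled if either $|\{\overline{t_1},\ldots,\overline{t_n}\}|<n$, or $|\{\overline{t_1},\ldots,\overline{t_n}\}|=n$ and $\{\overline{t_1},\ldots,\overline{t_n}\}$ (with the inherited ordering) is not a C-string for $\overline{G}$. It is called unravelled if it is $N$-unravelled for every non-trivial proper normal subgroup $N$ of $G$. *)

(* Defs.v *)
From HB Require Import structures.
From mathcomp Require Import all_boot all_order all_algebra all_fingroup.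

Set Implicit Arguments.
Unset Strict Implicit.
Unset Printing Implicit Defensive.

Import GroupScope GRing.Theory.

Section SpecialLinear.

Variables (n : nat) (F : finFieldType).

Definition SLgroup : {set {'GL_n[F]}} :=
  [set A : {'GL_n[F]} | (\det (GLval A) == 1)%R].

Lemma SLgroup_group_set : group_set SLgroup.
Proof.
apply/group_setP; split=> [|A B]; first by rewrite inE GL_1E det1.
by rewrite !inE GL_ME det_mulmx => /eqP-> /eqP->; rewrite mulr1.
Qed.
Canonical SLgroup_group := Group SLgroup_group_set.

Lemma trinv_unit (A : {'GL_n[F]}) :
  invmx (GLval A)^T \is a @GRing.unit 'M[F]_n.-1.+1.
Proof. by have := GL_unitmx A; rewrite -unitmx_tr -unitmx_inv. Qed.

Definition trinv (A : {'GL_n[F]}) : {'GL_n[F]} :=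
  Sub (invmx (GLval A)^T) (trinv_unit A).

Lemma trinvE A : GLval (trinv A) = invmx (GLval A)^T.
Proof. exact: SubK. Qed.

Lemma trinvK : involutive trinv.
Proof. by move=> A; apply: val_inj; rewrite /= trmx_inv trmxK invmxK. Qed.

Lemma trinvM : {morph trinv : A B / A * B}.
Proof.
have unitT (A : {'GL_n[F]}) : (GLval A)^T%R \in unitmx.
  by rewrite unitmx_tr GL_unitmx.
move=> A B; apply: val_inj; change (GLval (trinv (A * B)) =
  (GLval (trinv A) * GLval (trinv B))%R).
rewrite !trinvE GL_ME trmx_mul.
exact: (@invrM 'M[F]_n.-1.+1 _ _ (unitT B) (unitT A)).
Qed.

(* The additive group 'Z_2 = {0, 1} is the cyclic group of order 2, written
   multiplicatively in group_scope; its generator 1%R acts as trinv. *)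
Definition trinv_act (A : {'GL_n[F]}) (b : 'Z_2) : {'GL_n[F]} :=
  if b == 0%R then A else trinv A.

Lemma trinv_is_action : is_action [set: 'Z_2] trinv_act.
Proof.
apply: is_total_action => [A // | A [[|[]] // ia] [[|[]] // ib]].
by rewrite /trinv_act /= trinvK.
Qed.
Canonical trinv_action := Action trinv_is_action.

Lemma trinv_is_groupAction : is_groupAction [set: {'GL_n[F]}] trinv_action.
Proof.
move=> b _; rewrite inE; apply/andP; split.
  by apply/subsetP=> A _; rewrite inE.
apply/morphicP=> A B _ _; rewrite !actpermE /= /trinv_act.
by case: (b == 0%R); rewrite ?trinvM.
Qed.
Canonical trinv_groupAction := GroupAction trinv_is_groupAction.

Lemma trinv_acts_SL :
  {acts [set: 'Z_2], on group SLgroup | trinv_groupAction}.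
Proof.
split; last exact: subsetT.
apply/subsetP=> b _; rewrite !inE /=; apply/subsetP=> A.
rewrite !inE /= /trinv_act; case: (b == 0%R) => //.
by rewrite trinvE det_inv det_tr invr_eq1.
Qed.

Definition SL_trinv_sdprod : finGroupType :=
  sdprod_groupType <[trinv_acts_SL]>%gact.

End SpecialLinear.

Section CStrings.

Variables (gT : finGroupType) (n : nat).

(* The indices 1, ..., n are shifted to 0, ..., n - 1. *)
Definition subgen (t : n.-tuple gT) (J : {set 'I_n}) : {set gT} :=
  <<[set tnth t j | j in J]>>.

(* The t_i of a C-string are automatically pairwise distinct: if t_i = t_j with
   i != j, the intersection property puts t_i in subgen t set0 = 1. *)
Definition Cstring (G : {set gT}) (t : n.-tuple gT) : Prop :=
  [/\ forall i, #[tnth t i] = 2,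
      G = subgen t [set: 'I_n],
      forall i j : 'I_n, (i.+2 <= j) || (j.+2 <= i) ->
        commute (tnth t i) (tnth t j)
    & forall J K : {set 'I_n},
        subgen t J :&: subgen t K = subgen t (J :&: K)].

Definition schlafli (t : n.-tuple gT) : seq nat :=
  if tval t is x :: s then pairmap (fun y z => #[y * z]) x s else [::].

End CStrings.

Section Unravelled.

Variables (gT : finGroupType) (n : nat).

Definition N_unravelled (G N : {group gT}) (t : n.-tuple gT) : Prop :=
  let tbar : n.-tuple (coset_of N) := map_tuple (coset N) t in
  #|[set x in tbar]| < n \/
  #|[set x in tbar]| = n /\ ~ Cstring (G / N) tbar.

Definition unravelled (G : {group gT}) (t : n.-tuple gT) : Prop :=
  forall N : {group gT}, N <| G -> N :!=: 1 -> N \proper G ->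
    N_unravelled G N t.

End Unravelled.

(* Main.v *)
Require Import Defs.
From mathcomp Require Import all_boot all_order all_algebra all_fingroup.
From mathcomp Require Import all_solvable all_field.
From mathcomp Require Import ring zify.

(** The elements of the group are the matrices X of determinant 1 and the
    products t X, multiplied by the rule (t X)(t Y) = X^-T Y.  Hence t X is an
    involution exactly when X is symmetric, that is, when X is the Gram matrix
    of a quadratic form, and the matrices commuting with t X are the isometries
    of that form.  The string is assembled from two such outer involutions,
    tA = t, belonging to x^2 + y^2 + z^2, and tB = t (om J), belonging to
    -x^2 - y^2 + z^2, where J = diag(-1, -1, 1) and om is a primitive cube root
    of unity:

    - t1 and t2 are half turns about axes in the plane z = 0, isometries of both
      forms;
    - t0 = tA S and t3 = tB S', where S and S' are isometries of the first and
      of the second form.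

    _Arithmetic._  Condition (iii) says that t1 t2, a rotation of the plane with
    cosine -1/3, has order q + 1.  It also forces -1 to be a nonsquare, so the
    plane is anisotropic and has q + 1 rotations: all of them are powers of
    t1 t2 ([rotation_cycle]), and <t1, t2> is the whole orthogonal group of the
    plane.  As the two fields of the statement are only linked by their
    cardinals, orders are transferred from one to the other through integer
    recurrences ([order_transfer]).

    _Intersection property._  In rank 4 everything reduces to <t0, t1, t2> and
    <t1, t2, t3> meeting in <t1, t2>, plus small facts on dihedral groups of
    order 8 ([subgen_setI]).  The first group centralises tA and the second
    centralises tB.  An element centralising both centralises tA tB = om J, which
    has order 6, and outer elements cannot do that; so it is an isometry of both
    forms, and these are the elements of <t1, t2> ([cap_G123_G234]).

    _Generation._  A group that contains all the rotations about the z-axis and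
    their conjugates by one isometry moving the pole to height -1/2 contains
    more than half of the special orthogonal group, hence all of it ([SO_gen]).
    So <t0, t1, t2> and <t1, t2, t3> contain the two special orthogonal groups,
    and in particular tA and tB.  A suitable Euclidean rotation of the first
    group times a hyperbolic rotation of the second is a transvection, and from
    there the two groups generate every elementary matrix ([SO_gen_SL]).

    _Unravelling._  Let N be a nontrivial proper normal subgroup.  If it contains
    a nonscalar matrix it contains all the matrices of determinant 1, and the
    images of t1 and t2 coincide.  Otherwise it consists of the scalar matrices
    of cube 1.  Modulo these, tA equals tB J; so the image of tA lies in the
    images of both <t0, t1, t2> and <t1, t2, t3>, but it is not in the image of
    <t1, t2>, since tA is outer: the intersection property fails
    ([quotient_not_Cstring]). *)

Set Implicit Arguments.
Unset Strict Implicit.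
Unset Printing Implicit Defensive.
Import GroupScope GRing.Theory.

Local Notation o0 := (Ordinal (isT : 0 < 3)%N).
Local Notation o1 := (Ordinal (isT : 1 < 3)%N).
Local Notation o2 := (Ordinal (isT : 2 < 3)%N).

(** * Explicit matrices of size 3 *)

Section Mx3.
Local Open Scope ring_scope.
Variable F : fieldType.
Implicit Types A B : 'M[F]_3.

(** Products, transposes and determinants of such literals compute to literals,
    so that matrix identities split into nine polynomial identities. *)
Definition mx3 (a b c d e f g h i : F) : 'M[F]_3 :=
  \matrix_(x, y) nth 0 (nth [::] [:: [:: a; b; c]; [:: d; e; f]; [:: g; h; i]] x) y.

Lemma mx3_eta A : A = mx3 (A 0 0) (A 0 1) (A 0 2) (A 1 0) (A 1 1) (A 1 2) (A 2 0) (A 2 1) (A 2 2).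
Proof.
by apply/matrixP=> -[[|[|[|//]]] hi] [[|[|[|//]]] hj]; rewrite mxE /=; congr (A _ _); apply: val_inj.
Qed.

Lemma mx3P A : exists a b c d e f g h i, A = mx3 a b c d e f g h i.
Proof. by do 9!eexists; apply: mx3_eta. Qed.

Lemma mul_mx3 a b c d e f g h i a' b' c' d' e' f' g' h' i' :
  mx3 a b c d e f g h i *m mx3 a' b' c' d' e' f' g' h' i' =
  mx3 (a*a'+b*d'+c*g') (a*b'+b*e'+c*h') (a*c'+b*f'+c*i')
      (d*a'+e*d'+f*g') (d*b'+e*e'+f*h') (d*c'+e*f'+f*i')
      (g*a'+h*d'+i*g') (g*b'+h*e'+i*h') (g*c'+h*f'+i*i').
Proof.
apply/matrixP=> -[[|[|[|//]]] hi] [[|[|[|//]]] hj];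
 by rewrite !mxE !big_ord_recl big_ord0 !mxE /= addr0 addrA.
Qed.

Lemma tr_mx3 a b c d e f g h i :
  (mx3 a b c d e f g h i)^T = mx3 a d g b e h c f i.
Proof. by apply/matrixP=> -[[|[|[|//]]] hi] [[|[|[|//]]] hj]; rewrite !mxE. Qed.

Lemma scale_mx3 k a b c d e f g h i :
  k *: mx3 a b c d e f g h i = mx3 (k*a) (k*b) (k*c) (k*d) (k*e) (k*f) (k*g) (k*h) (k*i).
Proof. by apply/matrixP=> -[[|[|[|//]]] hi] [[|[|[|//]]] hj]; rewrite !mxE. Qed.

Lemma scalar_mx3 k : k%:M = mx3 k 0 0 0 k 0 0 0 k.
Proof. by apply/matrixP=> -[[|[|[|//]]] hi] [[|[|[|//]]] hj]; rewrite !mxE. Qed.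

Lemma det_mx3 a b c d e f g h i :
  \det (mx3 a b c d e f g h i) =
  a * (e * i - f * h) - b * (d * i - f * g) + c * (d * h - e * g).
Proof.
rewrite (expand_det_row _ ord0) !big_ord_recl big_ord0 /cofactor.
rewrite !(expand_det_row _ ord0) !big_ord_recl !big_ord0 /cofactor !det_mx11 !mxE /=.
by rewrite /bump /= ; ring.
Qed.

Lemma mx3_inj a b c d e f g h i a' b' c' d' e' f' g' h' i' :
  mx3 a b c d e f g h i = mx3 a' b' c' d' e' f' g' h' i' ->
  [/\ [/\ a = a', b = b' & c = c'], [/\ d = d', e = e' & f = f'] &
      [/\ g = g', h = h' & i = i']].
Proof.
move/matrixP=> E; have E' x y := E (inord x) (inord y).
move: (E' 0 0)%N (E' 0 1)%N (E' 0 2)%N (E' 1 0)%N (E' 1 1)%N (E' 1 2)%N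
  (E' 2 0)%N (E' 2 1)%N (E' 2 2)%N; rewrite !mxE !inordK //=.
Qed.

Lemma eq_mx3 a b c d e f g h i a' b' c' d' e' f' g' h' i' :
  a = a' -> b = b' -> c = c' -> d = d' -> e = e' -> f = f' -> g = g' -> h = h' -> i = i' ->
  mx3 a b c d e f g h i = mx3 a' b' c' d' e' f' g' h' i'.
Proof. by do 9!move->. Qed.

End Mx3.

(** * The extension of SL_3 by the inverse transpose *)

Section Group.
Variable F : finFieldType.
Local Notation gT := (SL_trinv_sdprod 3 F).
Implicit Types g h : gT.

Definition outer g : bool := g.1 != 0%R.
Definition mx g : 'M[F]_3 := GLval g.2.

Lemma det_mx g : (\det (mx g) = 1)%R.
Proof. by case: g => [[b A] gA]; have /setXP[_] := gA; rewrite inE => /eqP. Qed.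

Lemma mx_unit g : mx g \in unitmx.
Proof. by rewrite unitmxE det_mx unitr1. Qed.

Lemma gP g h : outer g = outer h -> mx g = mx h -> g = h.
Proof.
move=> eo em; apply: val_inj => /=.
case: g h eo em => [[b A] /= gA] [[c B] /= gB]; rewrite /outer /mx /= => eo eAB.
have <- : A = B by apply: val_inj.
congr pair; move: eo {gA gB}; case: b c => [[|[|//]] hb] [[|[|//]] hc] //= _; exact: val_inj.
Qed.

Lemma outer1 : outer 1 = false. Proof. by []. Qed.
Lemma mx1 : mx 1 = 1%:M%R. Proof. by []. Qed.

Lemma outerM g h : outer (g * h) = outer g (+) outer h.
Proof.
case: g h => [[[[|[|//]] hb] A] /= gA] [[[[|[|//]] hc] B] /= gB]; rewrite /outer //=.
Qed.

(** Moving t to the left across the matrix of [g] replaces that matrix by its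
    inverse transpose. *)
Lemma mxM g h :
  mx (g * h) = ((if outer h then invmx (mx g)^T else mx g) *m mx h)%R.
Proof.
case: g h => [[b A] /= gA] [[c B] /= gB]; rewrite /mx /outer /=.
case/setXP: (gA) => _ sA.
change (GLval (<[@trinv_acts_SL 3 F]>%gact A c * B)%g =
  (if c != 0%R then invmx (GLval A)^T else GLval A) *m GLval B)%R.
rewrite GL_ME; congr mulmx.
rewrite (actbyE _ sA (in_setT c)).
by rewrite /= /trinv_act; case: (c == 0%R) => //=; rewrite trinvE.
Qed.

Lemma exists_elt (b : bool) (A : 'M[F]_3) : (\det A = 1)%R ->
  exists2 g : gT, outer g = b & mx g = A.
Proof.
move=> dA; have uA : A \is a @GRing.unit 'M[F]_3.-1.+1 by rewrite unitmxE dA unitr1.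
pose a : {'GL_3[F]} := FinRing.unit _ uA.
have ab : ((if b then 1%R else 0%R) : 'Z_2, a) \in setX [set: 'Z_2] (SLgroup 3 F).
  by rewrite !inE /= dA.
by exists (SdPair <[@trinv_acts_SL 3 F]>%gact ab); rewrite // /outer /=; case: b ab.
Qed.

End Group.

(** * The intersection property in rank 4 *)

Section RankFour.
Variable gT : finGroupType.

(** An involution commuting with a group adds only one coset to it. *)
Lemma gen_setU1_centP (x : gT) (A B : {set gT}) :
  x ^+ 2 = 1 -> {in B, forall y, commute x y} -> A \subset x |: B ->
  forall y, y \in <<A>> -> exists2 h, h \in <<B>> & y = h \/ y = x * h.
Proof.
move=> x2 cxB sAB y yA.
have nB : <[x]> \subset 'N(<<B>>).
  by apply: cents_norm; rewrite cycle_subG /= cent_gen; apply/centP=> z /cxB.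
have : y \in <[x]> * <<B>>.
  rewrite -norm_joinEl //; apply: subsetP yA; rewrite gen_subG.
  apply: subset_trans sAB _; rewrite subUset sub1set.
  rewrite (subsetP (joing_subl _ _)) ?cycle_id //=.
  exact: subset_trans (subset_gen B) (joing_subr _ _).
case/mulsgP=> z h /cycleP[n ->] hB ->; exists h => //.
rewrite -(odd_double_half n) expgD -muln2 mulnC expgM x2 expg1n mulg1.
by case: (odd n); rewrite ?mul1g; [right | left].
Qed.

Variables t0 t1 t2 t3 : gT.
Let s := [:: t0; t1; t2; t3].
Let t := [tuple t0; t1; t2; t3].

(** The parabolic subgroups as functions of four membership bits: inclusions
    between them and case analyses on subsets then become computations. *)
Definition gens (a b c d : bool) : {group gT} :=
  <<[set x in mask [:: a; b; c; d] s]>>%G.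

Lemma mem_mask4 (a b c d : bool) x :
  (x \in mask [:: a; b; c; d] s) =
  [|| a && (x == t0), b && (x == t1), c && (x == t2) | d && (x == t3)].
Proof. by case: a; case: b; case: c; case: d; rewrite /= ?inE ?orbF. Qed.

Lemma subgen_gens (J : {set 'I_4}) : exists a b c d,
  subgen t J = gens a b c d /\ forall i : 'I_4, (i \in J) = nth false [:: a; b; c; d] i.
Proof.
pose o (k : nat) (hk : (k < 4)%N) := Ordinal hk.
have E (i : 'I_4) : (i \in J) =
    nth false [:: @o 0%N isT \in J; @o 1%N isT \in J; @o 2 isT \in J; @o 3 isT \in J] i.
  by case: i => [[|[|[|[|//]]]] hi] /=; congr (_ \in J); apply: val_inj.
move: E; set a := _ \in J; set b := _ \in J; set c := _ \in J; set d := _ \in J => E.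
exists a, b, c, d; split=> //; congr <<_>>; apply/setP=> x; rewrite inE mem_mask4.
apply/imsetP/or4P => [[i]|].
  rewrite E => iJ ->; rewrite (tnth_nth 1); move: iJ.
  by case: i => [[|[|[|[|//]]]] hi] /= ->; rewrite eqxx;
    [constructor 1 | constructor 2 | constructor 3 | constructor 4].
by case=> /andP[iJ /eqP->]; [exists (@o 0%N isT) | exists (@o 1%N isT)
  | exists (@o 2 isT) | exists (@o 3 isT)]; rewrite ?E // (tnth_nth 1).
Qed.

Lemma subgen_bits (a b c d : bool) :
  subgen t [set i : 'I_4 | nth false [:: a; b; c; d] i] = gens a b c d.
Proof.
pose o (k : nat) (hk : (k < 4)%N) := Ordinal hk.
have [a' [b' [c' [d' [-> H]]]]] := subgen_gens [set i : 'I_4 | nth false [:: a; b; c; d] i].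
move: (H (o 0%N isT)) (H (o 1%N isT)) (H (o 2 isT)) (H (o 3 isT)).
by rewrite !inE /= => -> -> -> ->.
Qed.

(** The order of the two generators is that of [dihedral8_cap]. *)
Lemma gens_last2 : gens false false true true = <<[set x in [:: t3; t2]]>>%G.
Proof. by congr (<<_>>%G); apply/setP=> x; rewrite !inE orbC. Qed.

Lemma gens_subG (a b c d : bool) (H : {group gT}) : (a -> t0 \in H) -> (b -> t1 \in H) ->
  (c -> t2 \in H) -> (d -> t3 \in H) -> gens a b c d \subset H.
Proof.
move=> h0 h1 h2 h3; rewrite gen_subG; apply/subsetP=> x; rewrite inE mem_mask4.
by case/or4P=> /andP[k /eqP->]; auto.
Qed.

Lemma mem_gens (a b c d : bool) : [/\ a -> t0 \in gens a b c d, b -> t1 \in gens a b c d,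
  c -> t2 \in gens a b c d & d -> t3 \in gens a b c d].
Proof. by split=> k; apply: mem_gen; rewrite inE mem_mask4 k eqxx ?orbT. Qed.

Lemma gensS a b c d a' b' c' d' :
  [&& a ==> a', b ==> b', c ==> c' & d ==> d'] -> gens a b c d \subset gens a' b' c' d'.
Proof.
case/and4P=> ha hb hc hd; apply: genS; apply/subsetP=> x; rewrite !inE !mem_mask4.
by case/or4P=> /andP[k ->];
  rewrite ?(implyP ha k) ?(implyP hb k) ?(implyP hc k) ?(implyP hd k) ?orbT.
Qed.

Hypotheses (v0 : t0 ^+ 2 = 1) (v3 : t3 ^+ 2 = 1).
Hypotheses (c02 : commute t0 t2) (c03 : commute t0 t3) (c13 : commute t1 t3).

Lemma gens_splitl c d x : x \in gens true false c d ->
  exists2 h, h \in gens false false c d & x = h \/ x = t0 * h.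
Proof.
apply: gen_setU1_centP => // [y|]; last first.
  by apply/subsetP=> y; rewrite !inE !mem_mask4.
by rewrite inE mem_mask4 => /or4P[]//= /andP[_ /eqP->].
Qed.

Lemma gens_splitr a b x : x \in gens a b false true ->
  exists2 h, h \in gens a b false false & x = h \/ x = t3 * h.
Proof.
apply: gen_setU1_centP => // [y|]; last first.
  apply/subsetP=> y; rewrite !inE !mem_mask4 /=.
  by case: (y == t3); rewrite ?orbT ?orbF ?andbF ?orbF.
by rewrite inE mem_mask4 => /or4P[]//= /andP[_ /eqP->]; apply: commute_sym.
Qed.

Hypotheses (hM : gens true true true false :&: gens false true true true
                   \subset gens false true true false)
 (h1 : gens true true false false :&: gens false true true false \subset <[t1]>)
 (h2 : gens false false true true :&: gens false true true false \subset <[t2]>)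
 (v1 : t1 ^+ 2 = 1) (v2 : t2 ^+ 2 = 1)
 (n0 : t0 \notin gens false true true false) (n3 : t3 \notin gens false true true false)
 (n12 : t1 != t2).

Local Notation g a b c d := (gens a b c d).
Local Notation "'O'" := false. Local Notation "'I'" := true.

Lemma mem_gens1 : [/\ t0 \in g I O O O, t1 \in g O I O O, t2 \in g O O I O & t3 \in g O O O I].
Proof. by split; apply: mem_gen; rewrite !inE. Qed.

(** Each parabolic subgroup is the intersection of the maximal ones above it.
    The pairs come first.  A maximal subgroup that omits an inner node is the
    product of the generator at one end and a dihedral group; an element of it
    that lies in another maximal subgroup loses the end generator, because t0 and
    t3 are not in the maximal subgroup generated by the other three. *)
Lemma gensP a b c d x :
  (~~ a -> x \in g O I I I) -> (~~ b -> x \in g I O I I) ->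
  (~~ c -> x \in g I I O I) -> (~~ d -> x \in g I I I O) ->
  x \in g I I I I -> x \in g a b c d.
Proof.
have [m0 m1 m2 m3] := mem_gens1.
have S e f k l a' b' c' d' y : y \in g e f k l ->
    [&& e ==> a', f ==> b', k ==> c' & l ==> d'] -> y \in g a' b' c' d'.
  by move=> yg H; apply: (subsetP (gensS H)).
have q03 y : y \in g O I I I -> y \in g I I I O -> y \in g O I I O.
  by move=> ya yb; apply: (subsetP hM); rewrite inE yb.
have t0M : t0 \notin g O I I I.
  by apply: contra n0 => ha; apply: q03 ha (S _ _ _ _ _ _ _ _ _ m0 _).
have t3M : t3 \notin g I I I O.
  by apply: contra n3 => ha; apply: q03 (S _ _ _ _ _ _ _ _ _ m3 _) ha.
have q1 y : y \in g I I O O -> y \in g O I I O -> y \in g O I O O.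
  move=> ya yb; have /cycleP[n ->] : y \in <[t1]> by apply: (subsetP h1); rewrite inE ya.
  exact: groupX.
have q2 y : y \in g O O I I -> y \in g O I I O -> y \in g O O I O.
  move=> ya yb; have /cycleP[n ->] : y \in <[t2]> by apply: (subsetP h2); rewrite inE ya.
  exact: groupX.
have q12 y : y \in g I I O O -> y \in g O O I I -> y = 1.
  move=> ya yb; have yc : y \in g O I I O by apply: q03; [apply: S yb _ | apply: S ya _].
  have /cycleP[n yn] : y \in <[t1]> by apply: (subsetP h1); rewrite inE ya.
  have /cycleP[m ym] : y \in <[t2]> by apply: (subsetP h2); rewrite inE yb.
  move: yn ym; rewrite -(odd_double_half n) -(odd_double_half m).
  rewrite !expgD -!muln2 ![(_./2 * _)%N]mulnC !expgM v1 v2 !expg1n !mulg1.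
  by case: (odd n) => [->|] //; case: (odd m) => // /eqP; rewrite (negPf n12).
have split0 y c' d' : y \in g I O c' d' -> y \in g O I I I -> y \in g O O c' d'.
  case/gens_splitl=> h hg [-> //|->] hm; case/negP: t0M.
  by rewrite -(groupMr _ (x := h)) //; apply: S hg _; rewrite ?implybT.
have split3 y a' b' : y \in g a' b' O I -> y \in g I I I O -> y \in g a' b' O O.
  case/gens_splitr=> h hg [-> //|->] hm; case/negP: t3M.
  by rewrite -(groupMr _ (x := h)) //; apply: S hg _; rewrite ?implybT.
have p01 y : y \in g O I I I -> y \in g I O I I -> y \in g O O I I by move=> ya yb; apply: split0.
have p23 y : y \in g I I I O -> y \in g I I O I -> y \in g I I O O by move=> ya yb; apply: split3.
have p02 y : y \in g O I I I -> y \in g I I O I -> y \in g O I O I.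
  move=> ya /gens_splitr[k kg [yk|yk]].
    by apply: (S O I O O) => //; rewrite yk in ya *; apply: q1 => //; apply: q03 => //; apply: S kg _.
  have ka : k \in g O I I I by rewrite yk groupMl // in ya; apply: S m3 _.
  rewrite yk groupM //; first by apply: S m3 _.
  by apply: (S O I O O) => //; apply: q1 => //; apply: q03 => //; apply: S kg _.
have p13 y : y \in g I O I I -> y \in g I I I O -> y \in g I O I O.
  move=> /gens_splitl[k kg [yk|yk]] ya.
    by apply: (S O O I O) => //; rewrite yk in ya *; apply: q2 => //; apply: q03 => //; apply: S kg _.
  have ka : k \in g I I I O by rewrite yk groupMl // in ya; apply: S m0 _.
  rewrite yk groupM //; first by apply: S m0 _.
  by apply: (S O O I O) => //; apply: q2 => //; apply: q03 => //; apply: S kg _.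
have p12 y : y \in g I O I I -> y \in g I I O I -> y \in g I O O I.
  have n0' : t0 \in g I I O O by apply: S m0 _.
  have n3' : t3 \in g O O I I by apply: S m3 _.
  have r0 : t0 \in g I O O I by apply: S m0 _.
  have r3 : t3 \in g I O O I by apply: S m3 _.
  case/gens_splitl=> h hg yh /gens_splitr[k kg yk].
  case: yh yk => -> [] e.
  - by rewrite (q12 h) // e.
  - rewrite e; have -> : k = 1.
      apply: q12 => //; have -> : k = t3 * h by rewrite e mulgA -expg2 v3 mul1g.
      by rewrite groupM.
    by rewrite mulg1.
  - have -> : h = 1.
      apply: q12 => //; have -> : h = t0 * k by rewrite -e mulgA -expg2 v0 mul1g.
      by rewrite groupM.
    by rewrite mulg1.
  - have E : t3 * h = t0 * k.
      have -> : k = t3 * (t0 * h) by rewrite e mulgA -expg2 v3 mul1g.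
    by rewrite (mulgA t0) c03 -mulgA (mulgA t0) -expg2 v0 mul1g.
    have E1 : t3 * h = 1 by apply: q12; [rewrite E groupM | rewrite groupM].
    have -> : h = t3 by rewrite -[h]mul1g -v3 expg2 -mulgA E1 mulg1.
    by rewrite groupM.
have p012 y : y \in g O I I I -> y \in g I O I I -> y \in g I I O I -> y \in g O O O I.
  by move=> ya yb yc; apply: split0 ya; apply: p12.
have p123 y : y \in g I O I I -> y \in g I I O I -> y \in g I I I O -> y \in g I O O O.
  by move=> yb yc; apply: split3; apply: p12.
have p013 y : y \in g O I I I -> y \in g I O I I -> y \in g I I I O -> y \in g O O I O.
  by move=> ya yb yd; apply: split0 ya; apply: p13.
have p023 y : y \in g O I I I -> y \in g I I O I -> y \in g I I I O -> y \in g O I O O.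
  by move=> ya yc; apply: split3; apply: p02.
case: a; case: b; case: c; case: d => /= H0 H1 H2 H3 H; auto.
by apply: (split0 x false false); auto.
Qed.

(** By [gensP], both sides are the intersection of the maximal parabolic
    subgroups that omit a node outside the intersection of [J] and [K]. *)
Lemma subgen_setI (J K : {set 'I_4}) : subgen t J :&: subgen t K = subgen t (J :&: K).
Proof.
have [a [b [c [d [-> HJ]]]]] := subgen_gens J.
have [a' [b' [c' [d' [-> HK]]]]] := subgen_gens K.
have [e [f [k [l [-> HI]]]]] := subgen_gens (J :&: K).
pose o (k : nat) (hk : (k < 4)%N) := Ordinal hk.
have E (i : 'I_4) : nth false [:: e; f; k; l] i =
    nth false [:: a; b; c; d] i && nth false [:: a'; b'; c'; d'] i.
  by rewrite -HJ -HK -HI inE.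
move: (E (o 0%N isT)) (E (o 1%N isT)) (E (o 2 isT)) (E (o 3 isT)) => /= -> -> -> -> {E HI e f k l}.
apply/setP=> x; apply/setIP/idP=> [[xJ xK]|xJK].
  apply: gensP; rewrite ?negb_and.
  5: by apply: (subsetP (gensS _)) xJ; rewrite ?implybT.
  1-4: by case/orP=> n; [apply: (subsetP (gensS _)) xJ | apply: (subsetP (gensS _)) xK];
          rewrite (negPf n) ?implybT.
by split; apply: (subsetP (gensS _)) xJK; apply/and4P; split; apply/implyP=> /andP[].
Qed.

Lemma Cstring4 (H : {set gT}) : t0 != 1 -> t1 != 1 -> t2 != 1 -> t3 != 1 ->
  H = gens true true true true -> Cstring H t.
Proof.
move=> w0 w1 w2 w3 HE; split; last exact: subgen_setI.
- by case=> [[|[|[|[|//]]]] hi]; rewrite (tnth_nth 1); apply: nt_prime_order.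
- rewrite HE -subgen_bits; congr (subgen t _); apply/setP=> i; rewrite !inE.
  by case: i => [[|[|[|[|//]]]] hi].
case=> [[|[|[|[|//]]]] hi] [[|[|[|[|//]]]] hj] //= _; rewrite !(tnth_nth 1) //=; exact: commute_sym.
Qed.

Lemma schlafli4 : schlafli t = [:: #[t0 * t1]; #[t1 * t2]; #[t2 * t3]].
Proof. by []. Qed.

End RankFour.

(** * Group elements given by matrices *)

Section Elt.
Variable F : finFieldType.
Local Notation gT := (SL_trinv_sdprod 3 F).
Implicit Types (g h : gT) (A B : 'M[F]_3).

(** The group element with the given type and matrix.  A total function, so
    that matrices need not carry a proof of their determinant; the default value
    is taken only at matrices of determinant different from 1. *)
Definition elt (b : bool) A : gT :=
  odflt 1 [pick g | (outer g == b) && (mx g == A)].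

Lemma eltP b A : (\det A = 1)%R -> outer (elt b A) = b /\ mx (elt b A) = A.
Proof.
move=> dA; rewrite /elt; case: pickP => [g /andP[/eqP-> /eqP->]//|].
by have [g <- <-] := exists_elt b dA => /(_ g); rewrite !eqxx.
Qed.

Lemma eltK g : elt (outer g) (mx g) = g.
Proof. by have [eo em] := eltP (outer g) (det_mx g); apply: gP. Qed.

Lemma det_trV A : (\det A = 1 -> \det (invmx A^T) = 1)%R.
Proof. by move=> dA; rewrite det_inv det_tr dA invr1. Qed.

Lemma eltM b c A B : (\det A = 1)%R -> (\det B = 1)%R ->
  elt b A * elt c B = elt (b (+) c) ((if c then invmx A^T else A) *m B)%R.
Proof.
move=> dA dB; have [oA mA] := eltP b dA; have [oB mB] := eltP c dB.
rewrite -[LHS]eltK outerM mxM oA oB mA mB; congr elt.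
Qed.

Lemma eltMi b A B : (\det A = 1)%R -> (\det B = 1)%R -> elt b A * elt false B = elt b (A *m B)%R.
Proof. by move=> dA dB; rewrite eltM // addbF. Qed.

Lemma elt1 : elt false 1%:M%R = 1.
Proof. by rewrite -[RHS]eltK outer1 mx1. Qed.

Lemma eltV A : (\det A = 1)%R -> (elt false A)^-1 = elt false (invmx A).
Proof.
move=> dA; apply/eqP; rewrite eq_invg_mul eltMi // ?det_inv ?dA ?invr1 //.
by rewrite mulmxV ?elt1 // unitmxE dA unitr1.
Qed.

Lemma elt_inj b A B : (\det A = 1)%R -> (\det B = 1)%R -> elt b A = elt b B -> A = B.
Proof. by move=> dA dB E; rewrite -(eltP b dA).2 E (eltP b dB).2. Qed.

End Elt.

(** * Elementary matrices *)

Section Elementary.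
Local Open Scope ring_scope.
Variable F : fieldType.

Definition elem (i j : 'I_3) (a : F) : 'M[F]_3 := 1%:M + a *: delta_mx i j.


Lemma elemE i j a : elem i j a =
  let f x y := a * ((x == i) && (y == j))%:R in
  mx3 (1 + f o0 o0) (f o0 o1) (f o0 o2) (f o1 o0) (1 + f o1 o1) (f o1 o2)
      (f o2 o0) (f o2 o1) (1 + f o2 o2).
Proof.
by apply/matrixP=> -[[|[|[|//]]] hi] [[|[|[|//]]] hj]; rewrite !mxE /= ?add0r.
Qed.

Lemma ord3P (P : 'I_3 -> Prop) : P o0 -> P o1 -> P o2 -> forall i, P i.
Proof.
by move=> P0 P1 P2 [[|[|[|//]]] hi];
  [rewrite (_ : Ordinal _ = o0) | rewrite (_ : Ordinal _ = o1) | rewrite (_ : Ordinal _ = o2)] => //;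
  apply: val_inj.
Qed.

Lemma det_elem i j a : i != j -> \det (elem i j a) = 1.
Proof.
rewrite elemE; elim/ord3P: i; elim/ord3P: j => //= _; rewrite det_mx3 /=; ring.
Qed.

Lemma elemD i j a b : i != j -> elem i j a *m elem i j b = elem i j (a + b).
Proof.
rewrite !elemE; elim/ord3P: i; elim/ord3P: j => //= _; rewrite mul_mx3 /=; apply: eq_mx3; ring.
Qed.

(** The commutator formula of elementary matrices, which turns the parameters
    occurring in a subgroup into a ring. *)
Lemma elem_comm i j k a b : i != j -> j != k -> k != i ->
  elem i k a *m elem k j b *m elem i k (- a) *m elem k j (- b) = elem i j (a * b).
Proof.
rewrite !elemE; elim/ord3P: i; elim/ord3P: j; elim/ord3P: k => //= _ _ _;
  rewrite !mul_mx3 /=; apply: eq_mx3; ring.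
Qed.

Lemma elem_third (i j : 'I_3) : i != j -> exists2 k, j != k & k != i.
Proof.
by elim/ord3P: i; elim/ord3P: j => //= _;
  [exists o2 | exists o1 | exists o2 | exists o0 | exists o1 | exists o0].
Qed.

(** Comparing entries, commuting with 1 + E_ij kills the entries of column i
    and of row j off the diagonal and equates the diagonal entries i and j. *)
Lemma mulmx_scalar3 (A : 'M[F]_3) : (forall i j, i != j -> A *m elem i j 1 = elem i j 1 *m A) ->
  exists k, A = k%:M.
Proof.
have [a [b [c [d [e [f [g [h [i ->]]]]]]]]] := mx3P A => H.
exists a; rewrite scalar_mx3.
have := H o0 o1 isT; have := H o0 o2 isT; have := H o1 o0 isT; have := H o1 o2 isT;
have := H o2 o0 isT; have := H o2 o1 isT; rewrite !elemE /= !mul_mx3 {H}.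
rewrite !(mulr0, mul0r, mulr1, mul1r, addr0, add0r).
have eq0 (x y : F) : x + y = y -> x = 0 by rewrite -{2}[y]add0r => /addIr.
case/mx3_inj=> [[_ c0 _] [_ f0 _] [d0 ei _]].
case/mx3_inj=> [_ _ [ia b0 _]].
case/mx3_inj=> [_ [g0 h0 _] _] _ _ _.
have {}ia : i = a by apply: (addrI g); rewrite ia addrC.
have {}ei : e = i by apply: (addIr h); rewrite -ei addrC.
have fe : f + e = e by rewrite addrC.
have he : h + e = e by rewrite addrC -h0.
have gd : g + d = d by rewrite addrC -g0.
have cb : c + b = b by rewrite addrC.
by apply: eq_mx3; rewrite ?ei ?ia //; apply: eq0; first [exact: esym b0 | exact: cb | exact: esym d0
  | exact: fe | exact: gd | exact: he].
Qed.

(** The row operations that bring a nonzero first column to (1, 0, 0): the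
    first two make its last entry nonzero, the third uses that entry to produce
    the leading 1, and the last two clear the column. *)
Definition elim_col (x y z u v : F) : 'M[F]_3 :=
  elem o2 o0 v *m (elem o1 o0 u *m (elem o0 o2 z *m (elem o2 o0 y *m elem o2 o1 x))).

Lemma elim_colP a d g : ((a, d, g) != (0, 0, 0)) ->
  exists x y z u v, forall b c e f h i, exists b' c' e' f' h' i',
      elim_col x y z u v *m mx3 a b c d e f g h i = mx3 1 b' c' 0 e' f' 0 h' i'.
Proof.
move=> n0.
pose x : F := if (g == 0) && (d != 0) then 1 else 0.
pose y : F := if (g == 0) && (d == 0) then 1 else 0.
have k0 : g + x * d + y * a != 0.
  move: n0; rewrite /x /y; case: (eqVneq g 0) => [->|g0]; case: (eqVneq d 0) => [->|d0] /=;
  rewrite ?mul0r ?mul1r ?addr0 ?add0r //.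
  by apply: contra => /eqP->.
move Ek: (g + x * d + y * a) k0 => k k0.
have {Ek} -> : g = k - x * d - y * a by rewrite -Ek; ring.
exists x, y, ((1 - a) / k), (- d), (- k) => b c e f h i.
do 6!eexists; rewrite /elim_col !elemE /= !mul_mx3; apply: eq_mx3; try by []; by field.
Qed.

Lemma elim_blockP e f h i : e * i - f * h = 1 -> exists x y z u,
  elem o2 o1 z *m (elem o1 o2 y *m (elem o2 o1 x *m mx3 1 0 0 0 e f 0 h i)) *m elem o1 o2 u = 1%:M.
Proof.
move=> dt; pose x : F := if h == 0 then 1 else 0.
have k0 : h + x * e != 0.
  rewrite /x; case: (eqVneq h 0) => [h0|]; last by rewrite mul0r addr0.
  rewrite h0 mul1r add0r; apply: contra_eq_neq dt => ->; rewrite h0.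
  by rewrite mul0r mulr0 subrr eq_sym oner_eq0.
move Ek: (h + x * e) k0 => k k0.
have {Ek} Eh : h = k - x * e by rewrite -Ek; ring.
exists x, ((1 - e) / k), (- k), (- (f + (1 - e) / k * (i + x * f))).
rewrite !elemE scalar_mx3 /= !mul_mx3 Eh; rewrite Eh in dt.
by apply: eq_mx3; try by []; first [by field | by rewrite -[RHS]dt; field].
Qed.

End Elementary.

(** * Generation of SL_3 by elementary matrices *)

Section GenSL.
Local Open Scope ring_scope.
Variable F : finFieldType.
Local Notation gT := (SL_trinv_sdprod 3 F).
Local Notation inn := (@elt F false).

Lemma elt_elemV i j (a : F) : i != j -> ((inn (elem i j a))^-1 = inn (elem i j (- a)))%g.
Proof.
move=> ij; apply/eqP; rewrite eq_invg_mul eltMi ?det_elem // elemD // subrr.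
by rewrite /elem scale0r addr0 elt1.
Qed.

Variable H : {group gT}.

Lemma inn_mull A B : (\det A = 1) -> (\det B = 1) -> inn A \in H ->
  inn (A *m B) \in H -> inn B \in H.
Proof. by move=> dA dB hA; rewrite -eltMi // groupMl. Qed.

Lemma inn_mulr A B : (\det A = 1) -> (\det B = 1) -> inn B \in H ->
  inn (A *m B) \in H -> inn A \in H.
Proof. by move=> dA dB hB; rewrite -eltMi // groupMr. Qed.

Lemma det_elim_col x y z u v : (\det (elim_col x y z u v : 'M[F]_3) = 1).
Proof. by rewrite /elim_col !det_mulmx !det_elem // !mulr1. Qed.

(** Gaussian elimination: clear the first column, then the first row, then
    reduce the remaining block of size 2. *)
Lemma elem_gen_SL :
  (forall i j a, i != j -> inn (elem i j a) \in H) ->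
  forall g, outer g = false -> g \in H.
Proof.
move=> HE g og; rewrite -(eltK g) og; move: (mx g) (det_mx g) => A dA {g og}.
have col_in x y z u v : inn (elim_col x y z u v) \in H.
  by rewrite /elim_col -!eltMi ?det_mulmx ?det_elem // ?mulr1 // !groupM ?HE.
have [a [b [c [d [e [f [g [h [i EA]]]]]]]]] := mx3P A.
have n0 : (a, d, g) != (0, 0, 0).
  apply: contra_eq_neq dA => /= [[a0 d0 g0]]; rewrite EA det_mx3 a0 d0 g0.
  by rewrite !(mul0r, mulr0, subr0, addr0, sub0r, oppr0) eq_sym oner_eq0.
have [x [y [z [u [v /(_ b c e f h i)]]]]] := elim_colP n0.
case=> b' [c' [e' [f' [h' [i' EP]]]]].
apply: (@inn_mull (elim_col x y z u v)) => //; first exact: det_elim_col.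
have dB : (\det (mx3 1 b' c' 0 e' f' 0 h' i') = 1).
  by rewrite -EP -EA det_mulmx det_elim_col dA mulr1.
rewrite EA EP {A dA a b c d e f g h i EA EP n0 x y z u v}.
have dB' : (e' * i' - f' * h' = 1) by rewrite -dB det_mx3; ring.
apply: (@inn_mulr _ (elem o0 o1 (- b') *m elem o0 o2 (- c'))) => //.
- by rewrite det_mulmx !det_elem // mulr1.
- by rewrite -eltMi ?det_elem // groupM ?HE.
have -> : mx3 1 b' c' 0 e' f' 0 h' i' *m (elem o0 o1 (- b') *m elem o0 o2 (- c')) =
          mx3 1 0 0 0 e' f' 0 h' i'.
  by rewrite !elemE /= !mul_mx3; apply: eq_mx3; ring.
have {}dB : (\det (mx3 1 0 0 0 e' f' 0 h' i') = 1) by rewrite det_mx3 -[RHS]dB'; ring.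
have [x [y [z [u E1]]]] := elim_blockP dB'.
have dE i j a : i != j -> \det (elem i j a *m mx3 1 0 0 0 e' f' 0 h' i' : 'M[F]_3) = 1.
  by move=> ij; rewrite det_mulmx dB mulr1 det_elem.
have dE2 : (\det (elem o1 o2 y *m (elem o2 o1 x *m mx3 1 0 0 0 e' f' 0 h' i')) = 1).
  by rewrite det_mulmx dE // mulr1 det_elem.
have dE3 : (\det (elem o2 o1 z *m (elem o1 o2 y *m (elem o2 o1 x *m mx3 1 0 0 0 e' f' 0 h' i'))) = 1).
  by rewrite det_mulmx dE2 mulr1 det_elem.
have d12 a : (\det (elem o1 o2 a : 'M[F]_3) = 1) by apply: det_elem.
have d21 a : (\det (elem o2 o1 a : 'M[F]_3) = 1) by apply: det_elem.
apply: (inn_mull (d21 x) dB (HE o2 o1 x isT)).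
apply: (inn_mull (d12 y) (dE o2 o1 x isT) (HE o1 o2 y isT)).
apply: (inn_mull (d21 z) dE2 (HE o2 o1 z isT)).
apply: (inn_mulr dE3 (d12 u) (HE o1 o2 u isT)).
by rewrite E1 elt1.
Qed.

End GenSL.

(** * Normal subgroups *)

Section Normal.
Variable F : finFieldType.
Local Notation gT := (SL_trinv_sdprod 3 F).
Local Notation inn := (@elt F false).

Local Open Scope ring_scope.

Lemma det_transv (u : 'cV[F]_3) (h : 'rV[F]_3) : h *m u = 0 -> \det (1%:M + u *m h) = 1.
Proof.
move=> hu; rewrite [_ + _]mx3_eta det_mx3 !mxE !big_ord1 /=.
have {hu}: (h *m u) 0 0 = 0 by rewrite hu mxE.
rewrite mxE !big_ord_recl big_ord0 => E.
set i1 := lift ord0 ord0 in E; set i2 := lift ord0 (lift ord0 ord0) in E.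
have -> : (2%:R : 'I_3) = i2 by apply: val_inj.
have -> : (1 : 'I_3) = i1 by apply: val_inj.
rewrite -[RHS]addr0 -[in RHS]E; ring.
Qed.

Lemma mul_transvV (u : 'cV[F]_3) (h : 'rV[F]_3) : h *m u = 0 ->
  (1%:M + u *m h) *m (1%:M - u *m h) = 1%:M.
Proof.
move=> hu; rewrite mulmxDl !mulmxBr !mul1mx !mulmx1 mulmxA -(mulmxA u) hu mulmx0 mul0mx subr0.
by rewrite subrK.
Qed.

(** Two linear conditions on three coordinates have a nonzero solution. *)
Lemma common_annihilator (v v' : 'cV[F]_3) :
  exists2 h : 'rV[F]_3, h != 0 & h *m v = 0 /\ h *m v' = 0.
Proof.
have : kermx (row_mx v v') != 0.
  by rewrite kermx_eq0; apply/negP=> /eqP E; have := rank_leq_col (row_mx v v'); rewrite E.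
case/rowV0Pn=> h /sub_kermxP; rewrite mul_mx_row => E h0; exists h => //.
by have [] := eq_row_mx (etrans E (esym (@row_mx0 _ _ _ _))).
Qed.

Variable N : {group gT}.
Hypothesis nN : forall g h, g \in N -> (g ^ h \in N)%g.

Lemma mem_comml g h : g \in N -> (g * h * g^-1 * h^-1)%g \in N.
Proof.
move=> gN; have := nN h^-1 (groupVr gN); rewrite /conjg invgK => H.
by rewrite -!mulgA groupM // mulgA.
Qed.

Lemma mem_commr g h : g \in N -> (h * g * h^-1 * g^-1)%g \in N.
Proof.
move=> gN; have := nN h^-1 gN; rewrite /conjg invgK mulgA => H.
by rewrite groupM ?groupV.
Qed.

Definition has_transvection := exists (u : 'cV[F]_3) (h : 'rV[F]_3),
  [/\ u != 0, h != 0, h *m u = 0 & inn (1%:M + u *m h) \in N].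

(** Let A be the matrix of [a] and E an elementary matrix that does not commute
    with it.  The commutator B of A and E moves vectors only along a plane W, the
    kernel of a row h with h B = h.  Either B fixes W pointwise, and then B is a
    transvection; or B moves some w in W, and then the commutator of B and the
    transvection 1 + w h is the transvection 1 + (B w - w) h. *)
Lemma nonscalar_has_transvection a : a \in N -> outer a = false -> (forall k, mx a != k%:M) -> has_transvection.
Proof.
move=> aN oa nsa; set A := mx a in nsa.
have dA : \det A = 1 := det_mx a.
have uA : A \in unitmx := mx_unit a.
have aE : a = inn A by rewrite /A -oa eltK.
have [i [j [ij nAE]]] : exists i j, i != j /\ A *m elem i j 1 != elem i j 1 *m A.
  case: (boolP [exists i, exists j, (i != j) && (A *m elem i j 1 != elem i j 1 *m A)]).
    by case/existsP=> i /existsP[j /andP[]]; exists i, j.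
  move=> /existsPn H; have [k kA] : exists k, A = k%:M.
    apply: mulmx_scalar3 => i j ij; have /existsPn/(_ j) := H i.
    by rewrite ij negbK => /eqP.
  by have := nsa k; rewrite kA eqxx.
pose E : 'M[F]_3 := elem i j 1; pose E' : 'M[F]_3 := elem i j (-1).
have EE' : E *m E' = 1%:M by rewrite elemD // subrr /elem scale0r addr0.
have dE : \det E = 1 by apply: det_elem.
have dE' : \det E' = 1 by apply: det_elem.
have dA' : \det (invmx A) = 1 by rewrite det_inv dA invr1.
pose B := A *m E *m invmx A *m E'.
have bN : inn B \in N.
  have -> : inn B = (a * inn E * a^-1 * (inn E)^-1)%g.
    have -> : ((inn E)^-1 = inn E')%g.
      by apply/eqP; rewrite eq_invg_mul eltMi // EE' elt1.
    by rewrite aE eltV // !eltMi // !det_mulmx ?dA ?dE ?dA' ?mulr1.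
  exact: mem_comml.
have dB : \det B = 1 by rewrite !det_mulmx dA dE dA' dE' !mulr1.
have B1 : B != 1%:M.
  apply: contra nAE => /eqP B1.
  have : B *m E *m A = E *m A by rewrite B1 mul1mx.
  rewrite /B -!mulmxA (mulmxA E') (_ : E' *m E = 1%:M); last first.
    by rewrite elemD // addNr /elem scale0r addr0.
  by rewrite mul1mx mulVmx // mulmx1 => ->.
have [h h0 [h1 h2]] := common_annihilator (delta_mx i 0) (A *m delta_mx i 0).
have hE : h *m E' = h.
  rewrite /E' /elem mulmxDr mulmx1 -scalemxAr -(mul_delta_mx (0 : 'I_1)) mulmxA h1 mul0mx scaler0.
  by rewrite addr0.
have hAE : h *m (A *m E *m invmx A) = h.
  rewrite /E /elem scale1r mulmxDr mulmx1 mulmxDl mulmxV // mulmxDr mulmx1.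
  by rewrite -(mul_delta_mx (0 : 'I_1)) !mulmxA -(mulmxA h) h2 !mul0mx addr0.
have hB : h *m B = h by rewrite /B mulmxA hAE.
have uB : B \in unitmx by rewrite unitmxE dB unitr1.
have hBV : h *m invmx B = h by rewrite -[in LHS]hB mulmxK.
case: (boolP [exists w : 'cV[F]_3, (h *m w == 0) && (B *m w != w)]).
  case/existsP=> w /andP[/eqP hw Bw].
  exists (B *m w - w), h; split=> //; first by rewrite subr_eq0.
    by rewrite mulmxBr mulmxA hB subrr.
  have dw : \det (1%:M + w *m h) = 1 by apply: det_transv.
  have dw' : \det (1%:M - w *m h) = 1.
    by rewrite -mulNmx det_transv // mulmxN hw oppr0.
  suff -> : inn (1%:M + (B *m w - w) *m h) =
      (inn B * inn (1%:M + w *m h)%R * (inn B)^-1 * (inn (1%:M + w *m h)%R)^-1)%g.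
    exact: mem_comml.
  have -> : ((inn (1%:M + w *m h)%R)^-1 = inn (1%:M - w *m h)%R)%g.
    by apply/eqP; rewrite eq_invg_mul eltMi // mul_transvV ?elt1.
  have dB' : \det (invmx B) = 1 by rewrite det_inv dB invr1.
  rewrite eltV // !eltMi // ?det_mulmx ?dw ?dB' ?dA ?dE ?dA' ?dE' ?mulr1 //; congr (elt _ _).
  have -> : B *m (1%:M + w *m h) *m invmx B = 1%:M + B *m w *m h.
    by rewrite mulmxDr mulmx1 mulmxDl mulmxV // -!mulmxA hBV.
  rewrite mulmxBl mulmxBr mulmx1 mulmxDl mul1mx -!mulmxA (mulmxA h w) hw mul0mx !mulmx0.
  by rewrite addr0 addrA.
move/existsPn => H; have /rV0Pn[k hk] := h0.
pose y : 'cV[F]_3 := (h 0 k)^-1 *: delta_mx k 0.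
have hy : h *m y = 1%:M.
  rewrite /y -scalemxAr -colE; apply/matrixP=> r c; rewrite !ord1 !mxE mulVf //.
have BE : B - 1%:M = (B - 1%:M) *m y *m h.
  have : (B - 1%:M) *m (1%:M - y *m h) = 0.
    apply/matrixP=> r c.
    have -> : ((B - 1%:M) *m (1%:M - y *m h)) r c =
      ((B - 1%:M) *m ((1%:M - y *m h) *m delta_mx c (0 : 'I_1))) r 0.
      by rewrite mulmxA -colE [RHS]mxE.
    set w := _ *m delta_mx c _; have := H w.
    have -> : h *m w = 0 by rewrite /w mulmxA mulmxBr mulmx1 mulmxA hy mul1mx subrr mul0mx.
    by rewrite eqxx negbK => /eqP Bw; rewrite mulmxBl Bw mul1mx subrr mxE [RHS]mxE.
  by rewrite mulmxBr mulmx1 mulmxA => /eqP; rewrite subr_eq0 => /eqP.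
exists ((B - 1%:M) *m y), h; split=> //.
- apply: contra B1 => /eqP E0; rewrite -subr_eq0 BE E0 mul0mx.
  exact: eqxx.
- by rewrite mulmxA mulmxBr hB mulmx1 subrr mul0mx.
- by rewrite -BE addrC subrK.
Qed.

Lemma elem_sub_trans i j k : i != j -> k != i -> k != j ->
  (forall x, inn (elem i j x) \in N) ->
  (forall x, inn (elem i k x) \in N) /\ (forall x, inn (elem k j x) \in N).
Proof.
move=> ij ki kj H; have ik : i != k by rewrite eq_sym.
have jk : j != k by rewrite eq_sym.
split=> x.
  have <- : (inn (elem i j x) * inn (elem j k 1) * (inn (elem i j x))^-1 *
      (inn (elem j k 1))^-1)%g = inn (elem i k x).
    rewrite !elt_elemV // !eltMi ?det_mulmx ?det_elem ?mulr1 //; congr (elt _ _).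
    by rewrite elem_comm ?mulr1 // eq_sym.
  exact: mem_comml.
have <- : (inn (elem k i 1) * inn (elem i j x) * (inn (elem k i 1))^-1 *
    (inn (elem i j x))^-1)%g = inn (elem k j x).
  rewrite !elt_elemV // !eltMi ?det_mulmx ?det_elem ?mulr1 //; congr (elt _ _).
  by rewrite elem_comm ?mul1r // eq_sym.
exact: mem_commr.
Qed.

(** After conjugation the transvection becomes 1 + e_1 k with k = (0, a, b).  Its
    commutators with elementary matrices fill a whole root subgroup, from which
    further commutators reach the others. *)
Lemma has_transvection_SL : has_transvection -> forall g, outer g = false -> g \in N.
Proof.
case=> u [h [u0 h0 hu uhN]].
have [x [y [z [p [q]]]]] : exists x y z p q, elim_col x y z p q *m u = delta_mx 0 0.
  have n0 : (u o0 0, u o1 0, u o2 0) != (0, 0, 0).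
    apply: contra u0 => /eqP[E0 E1 E2]; apply/eqP/colP.
    by elim/ord3P; rewrite ?E0 ?E1 ?E2 mxE.
  have [x [y [z [p [q H]]]]] := elim_colP n0.
  exists x, y, z, p, q; have [b' [c' [e' [f' [h' [i' E]]]]]] := H 0 0 0 0 0 0.
  have -> : u = col 0 (mx3 (u o0 0) 0 0 (u o1 0) 0 0 (u o2 0) 0 0).
    by apply/colP; elim/ord3P; rewrite !mxE.
  rewrite colE mulmxA E -colE; apply/colP; by elim/ord3P; rewrite !mxE.
set P := elim_col x y z p q => Pu.
have dP : \det P = 1 by apply: det_elim_col.
clearbody P.
have uP : P \in unitmx by rewrite unitmxE dP unitr1.
have dP' : \det (invmx P) = 1 by rewrite det_inv dP invr1.
pose k := h *m invmx P.
have k00 : k 0 0 = 0.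
  have : k *m delta_mx 0 0 = 0 :> 'M_1 by rewrite -Pu mulmxA mulmxKV.
  by rewrite -colE => /matrixP/(_ 0 0); rewrite !mxE.
have k0 : k != 0.
  by apply: contra h0 => /eqP k0; rewrite -[h](mulmxKV uP) -/k k0 mul0mx.
have d1 := det_transv hu.
set a := k 0 o1; set b := k 0 o2.
have ab0 : (a != 0) || (b != 0).
  rewrite -negb_and; apply: contra k0 => /andP[/eqP a0 /eqP b0].
  apply/eqP/rowP; elim/ord3P; rewrite [RHS]mxE //.
  by rewrite -[RHS]k00; congr (k _ _); apply: val_inj.
have cN : inn (mx3 1 a b 0 1 0 0 0 1) \in N.
  have -> : inn (mx3 1 a b 0 1 0 0 0 1) = (inn P * inn (1%:M + u *m h)%R * (inn P)^-1)%g.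
    rewrite eltV // !eltMi ?det_mulmx ?dP ?d1 ?mulr1 //; congr (elt _ _).
    rewrite mulmxDr mulmx1 mulmxDl mulmxV // !mulmxA Pu -mulmxA -/k; clearbody k.
    apply/matrixP; elim/ord3P; elim/ord3P; rewrite !mxE /= big_ord1 !mxE /= ?mul0r ?mul1r ?addr0 ?add0r //.
    by rewrite -[LHS]addr0 -k00; congr (_ + k _ _); apply: val_inj.
  by have := nN (inn P)^-1 uhN; rewrite /conjg invgK mulgA.
have dm : \det (mx3 1 a b 0 1 0 0 0 1) = 1 by rewrite det_mx3; ring.
have dm' : \det (mx3 1 (- a) (- b) 0 1 0 0 0 1) = 1 by rewrite det_mx3; ring.
have cV : ((inn (mx3 1 a b 0 1 0 0 0 1))^-1 = inn (mx3 1 (- a) (- b) 0 1 0 0 0 1))%g.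
  apply/eqP; rewrite eq_invg_mul eltMi // -(elt1 F); apply/eqP; congr (elt _ _).
  by rewrite mul_mx3 scalar_mx3; apply: eq_mx3; ring.
have N12 : (forall t, inn (elem o0 o1 t) \in N) /\ (forall t, inn (elem o0 o2 t) \in N).
  have [a0|a0] := boolP (a == 0).
    have b0 : b != 0 by move: ab0; rewrite (eqP a0) eqxx.
    have H t : inn (elem o0 o1 t) \in N.
      suff -> : elem o0 o1 t = mx3 1 a b 0 1 0 0 0 1 *m elem o2 o1 (t / b) *m
          mx3 1 (- a) (- b) 0 1 0 0 0 1 *m elem o2 o1 (- (t / b)).
        by rewrite -!eltMi ?det_mulmx ?det_elem ?dm ?dm' ?mulr1 // -cV -elt_elemV // mem_comml.
      rewrite !elemE /= !mul_mx3 (eqP a0); apply: eq_mx3; by field.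
    by split=> //; have [] := @elem_sub_trans o0 o1 o2 isT isT isT H.
  have H t : inn (elem o0 o2 t) \in N.
    suff -> : elem o0 o2 t = mx3 1 a b 0 1 0 0 0 1 *m elem o1 o2 (t / a) *m
        mx3 1 (- a) (- b) 0 1 0 0 0 1 *m elem o1 o2 (- (t / a)).
      by rewrite -!eltMi ?det_mulmx ?det_elem ?dm ?dm' ?mulr1 // -cV -elt_elemV // mem_comml.
    rewrite !elemE /= !mul_mx3; apply: eq_mx3; by field.
  by split=> //; have [] := @elem_sub_trans o0 o2 o1 isT isT isT H.
apply: elem_gen_SL; case: N12 => H01 H02.
have [_ H21] := @elem_sub_trans o0 o1 o2 isT isT isT H01.
have [_ H12] := @elem_sub_trans o0 o2 o1 isT isT isT H02.
have [H20 _] := @elem_sub_trans o2 o1 o0 isT isT isT H21.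
have [H10 _] := @elem_sub_trans o1 o2 o0 isT isT isT H12.
by elim/ord3P; elim/ord3P.
Qed.

Lemma normal_nonscalar_SL : (exists2 a, a \in N & outer a = false /\ forall k, mx a != k%:M) ->
  forall g, outer g = false -> g \in N.
Proof. by case=> a aN [oa na]; apply: has_transvection_SL; apply: nonscalar_has_transvection na. Qed.

(** An outer element g of N has scalar commutators with all the elementary
    matrices, which means that its matrix X satisfies X = k (1 + E_ji) X (1 + E_ij)
    for some scalar k, for all i and j.  This forces the first row of X to vanish,
    whether k is 1 or not. *)
Lemma normal_scalar_inner : (forall a, a \in N -> outer a = false -> exists k, mx a = k%:M) ->
  forall g, g \in N -> outer g = false.
Proof.
move=> Hs g gN; apply/negbTE/negP => og.
have key i j : i != j -> exists k, mx g = k *: (elem j i 1 *m mx g *m elem i j 1).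
  move=> ij; have [os ms] := eltP false (@det_elem F i j 1 ij).
  set s := inn _ in os ms; have [c cN cs] : exists2 c, c \in N & (g * s = c * s * g)%g.
    by exists (g * s * g^-1 * s^-1)%g; [exact: mem_comml | rewrite !mulgKV].
  have oc : outer c = false.
    by move: (congr1 (@outer F) cs); rewrite !outerM os og; case: (outer c).
  have [k kc] := Hs c cN oc; exists k.
  have sT : (elem i j 1)^T = elem j i (1 : F).
    by rewrite /elem linearD linearZ /= tr_scalar_mx trmx_delta.
  have := congr1 (@mx F) cs; rewrite !mxM os og ms kc => E.
  have uk : (k%:M *m elem i j 1)^T \in unitmx.
    by rewrite unitmx_tr -kc -ms unitmx_mul !mx_unit.
  have EX : (k%:M *m elem i j 1)^T *m (mx g *m elem i j 1) = mx g.
    by rewrite E mulmxA mulmxV // mul1mx.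
  by rewrite -[LHS]EX trmx_mul sT tr_scalar_mx mul_mx_scalar -scalemxAl !mulmxA.
have k0 (k x y : F) : x = k * x -> y = k * (y + x) -> x = 0.
  move=> Ex; rewrite mulrDr -Ex.
  have [->|k1] := eqVneq k 1; first by rewrite mul1r => /eqP; rewrite -subr_eq0 opprD addNKr oppr_eq0 => /eqP.
  move=> _; apply/eqP; have: x * (k - 1) == 0 by rewrite mulrBr mulr1 mulrC -Ex subrr.
  by rewrite mulf_eq0 subr_eq0 (negPf k1) orbF.
have := key o0 o1 isT; have := key o0 o2 isT; have := det_mx g.
have [a [b [c [d [e [f [p [q [r ->]]]]]]]]] := mx3P (mx g) => dg.
rewrite !elemE /= !mul_mx3 !(mulr0, mul0r, mulr1, mul1r, addr0, add0r).
case=> k; rewrite scale_mx3 => /mx3_inj[[_ b1 _] _ [_ q1 _]].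
case=> l; rewrite scale_mx3 => /mx3_inj[[a1 _ c1] [d1 _ f1] _].
have b0 : b = 0 by apply: (k0 k b q b1); rewrite addrC.
have a0 : a = 0 by apply: (k0 l a d a1); rewrite addrC.
have c0 : c = 0 by apply: (k0 l c f c1); rewrite addrC.
move/eqP: dg; rewrite det_mx3 a0 b0 c0 !mul0r subr0 addr0 eq_sym oner_eq0 //.
Qed.

End Normal.

(** * A linear recurrence over the integers *)

Section Recurrence.
Local Open Scope ring_scope.

(** The integers a and b depend on k only.  Applied to the powers of a root of
    3 X^2 + 2 X + 3 in one field and to the coordinates of the powers of a
    rotation over another field of the same characteristic, they compare the
    orders of the two. *)
Lemma recurrence_int k : exists a b : int, forall (V : zmodType) (u : nat -> V),
  (forall n, u n.+2 *+ 3 + u n.+1 *+ 2 + u n *+ 3 = 0) ->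
  u k *+ (3 ^ k)%N = u 1%N *~ a + u 0%N *~ b.
Proof.
elim: k => [|k [a [b IH]]].
  by exists 0, 1 => V u _; rewrite mulr0z add0r expn0.
exists (3%N%:Z * b - 2%N%:Z * a), (- (3%N%:Z * a)) => V u Hu.
rewrite expnSr mulrnA (IH V (fun n => u n.+1)) //.
have E2 : u 2 *+ 3 = - (u 1%N *+ 2) - u 0%N *+ 3.
  by apply/eqP; rewrite -subr_eq0 opprD !opprK addrA Hu.
have T (x : V) (n : int) m : x *~ n *+ m = x *+ m *~ n by rewrite !pmulrn mulrzAC.
have M (x : V) (n : int) m : x *~ (m%:Z * n) = x *+ m *~ n by rewrite mulrzA.
rewrite mulrnDl T E2 mulrzBl mulNrz T mulrzBr mulrNz !M.
by rewrite addrC addrA.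
Qed.

(** Both roots z satisfy 3^k z^k = a z + b.  When their powers are 1 the affine
    function a z + b takes the value 3^k twice, so it is constant. *)
Lemma roots_pow1 (K : fieldType) (y y' : K) k (a b : int) :
  (forall (V : zmodType) (u : nat -> V),
    (forall n, u n.+2 *+ 3 + u n.+1 *+ 2 + u n *+ 3 = 0) ->
    u k *+ (3 ^ k)%N = u 1%N *~ a + u 0%N *~ b) ->
  3%:R != 0 :> K -> y != y' -> 
  3%:R * y ^+ 2 + 2%:R * y + 3%:R = 0 -> 3%:R * y' ^+ 2 + 2%:R * y' + 3%:R = 0 ->
  (y ^+ k = 1 /\ y' ^+ k = 1) <-> (a%:~R = 0 :> K /\ b%:~R = (3 ^ k)%N%:R :> K).
Proof.
move=> H n3 nyy hy hy'.
have E (z : K) : 3%:R * z ^+ 2 + 2%:R * z + 3%:R = 0 -> z ^+ k * (3 ^ k)%:R = z * a%:~R + b%:~R.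
  move=> hz; have := H K (fun n => z ^+ n); rewrite mulr_natr expr1 expr0 mulrzr => -> //.
  by move=> n; rewrite -[RHS](mul0r (z ^+ n)) -hz !exprS; ring.
have Ey := E y hy; have Ey' := E y' hy'.
have n3k : (3 ^ k)%:R != 0 :> K by rewrite natrX expf_neq0.
split=> [[y1 y1']|[a0 b0]].
  rewrite y1 mul1r in Ey; rewrite y1' mul1r in Ey'.
  have a0 : a%:~R = 0 :> K.
    have : (y - y') * a%:~R = 0 by rewrite mulrBl -(addrK b%:~R (y * _)) -Ey -(addrK b%:~R (y' * _)) -Ey' subrr.
    by move/eqP; rewrite mulf_eq0 subr_eq0 (negPf nyy) => /eqP.
  by split=> //; rewrite Ey a0 mulr0 add0r.
by split; apply: (mulIf n3k); rewrite mul1r ?Ey ?Ey' a0 mulr0 add0r b0.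
Qed.

End Recurrence.

(** * Consequences of the arithmetic conditions *)

Section Arith.
Local Open Scope ring_scope.
Variables (q : nat) (F : finFieldType).
Hypotheses (hF : #|F| = q) (hq : (6 %| q - 1)%N).

Lemma q_gt5 : (5 < q)%N.
Proof.
have : (0 < q - 1)%N by rewrite subn_gt0 -hF finNzRing_gt1.
by move/dvdn_leq => /(_ _ hq); lia.
Qed.

Lemma six_neq0 : 6%:R != 0 :> F.
Proof.
have [p pp chF] := finPcharP F.
rewrite -(dvdn_pcharf chF); apply: contraL pp => p6.
have pq : (p %| q)%N.
  have := card_pprimeChar chF; rewrite hF; case: (logn _ _) => [q1|k ->].
    by have := q_gt5; rewrite q1.
  exact: dvdn_exp.
have : (p %| 1)%N.
  have -> : 1%N = (q - (q - 1))%N by have := q_gt5; lia.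
  by rewrite dvdn_sub // (dvdn_trans p6).
by rewrite dvdn1 => /eqP->.
Qed.

Lemma two_neq0 : 2%:R != 0 :> F.
Proof. by apply: contra six_neq0 => /eqP E; rewrite (natrM F 2 3) E mul0r. Qed.
Lemma three_neq0 : 3%:R != 0 :> F.
Proof. by apply: contra six_neq0 => /eqP E; rewrite (natrM F 2 3) E mulr0. Qed.

(** If x is a primitive cube root of unity then (2 x + 1)^2 = -3. *)
Lemma sqrt_m3 : exists al : F, al ^+ 2 = - 3%:R.
Proof.
have : (3 %| #|[set: {unit F}]|)%N.
  by rewrite card_finField_unit hF -subn1 (dvdn_trans _ hq).
case/Cauchy=> // w _ ow; pose x : F := FinRing.uval w.
have x3 : x ^+ 3 = 1.
  by rewrite /x -FinRing.val_unitX -ow expg_order.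
have x1 : x != 1.
  apply: contra_eq_neq ow => x1; have -> : w = 1%g by apply: val_inj.
  by rewrite order1.
exists (2%:R * x + 1); have : (x - 1) * (x ^+ 2 + x + 1) = 0.
  have -> : (x - 1) * (x ^+ 2 + x + 1) = x ^+ 3 - 1 by ring.
  by rewrite x3 subrr.
move/eqP; rewrite mulf_eq0 subr_eq0 (negPf x1) => /eqP E.
by rewrite -[RHS](addr0) -[in RHS](mulr0 4%:R) -E; ring.
Qed.

Variable L : finFieldType.
Hypothesis hL : #|L| = (q ^ 2)%N.

Lemma natr_eq0_transfer n : (n%:R == 0 :> F) = (n%:R == 0 :> L).
Proof.
have [p pp chF] := finPcharP F.
have Eq : #|L| = (p ^ (logn p #|F| * 2))%N.
  by rewrite hL -hF [in LHS](card_pprimeChar chF) expnM.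
have chL := card_finPcharP Eq pp.
by rewrite -(dvdn_pcharf chF) -(dvdn_pcharf chL).
Qed.

Lemma intr_eq0_transfer (n : int) : (n%:~R == 0 :> F) = (n%:~R == 0 :> L).
Proof.
by case: n => n; rewrite ?NegzE ?mulrNz ?oppr_eq0; apply: natr_eq0_transfer.
Qed.

Variables (l : F) (r : L).
Hypotheses (hl : 2%:R * l ^+ 2 = 1) (hr : r ^+ 2 = 3%:R ^- 2 - 1).
Hypothesis hord : (q.+1.-primitive_root (- 3%:R^-1 + r))%R \/
            (q.+1.-primitive_root (- 3%:R^-1 - r))%R.

Lemma root_in_L : exists x x' : L, [/\ q.+1.-primitive_root x, x * x' = 1, x != x',
   3%:R * x ^+ 2 + 2%:R * x + 3%:R = 0 & 3%:R * x' ^+ 2 + 2%:R * x' + 3%:R = 0].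
Proof.
have n3 : 3%:R != 0 :> L by rewrite -natr_eq0_transfer three_neq0.
have q5 := q_gt5.
have n9 : 9%:R != 0 :> L by rewrite (natrM L 3 3) mulf_neq0.
have [r' hr' hx] : exists2 r' : L, r' ^+ 2 = 3%:R ^- 2 - 1 & q.+1.-primitive_root (- 3%:R^-1 + r').
  by case: hord => h; [exists r | exists (- r); rewrite ?sqrrN].
exists (- 3%:R^-1 + r'), (- 3%:R^-1 - r').
have xx : (- 3%:R^-1 + r') * (- 3%:R^-1 - r') = 1.
  by rewrite -[RHS](addrK (r' ^+ 2)) {1}hr'; field; rewrite n9 n3.
split=> //.
- apply/eqP=> E; have := prim_order_dvd hx 2; rewrite expr2 {2}E xx eqxx.
  by move/dvdn_leq => /(_ isT); lia.
- have -> : 3%:R * (- 3%:R^-1 + r') ^+ 2 + 2%:R * (- 3%:R^-1 + r') + 3%:R = 3%:R * r' ^+ 2 - 3%:R^-1 + 3%:R :> L by field.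
  by rewrite hr'; field; rewrite ?n9 ?n3.
- have -> : 3%:R * (- 3%:R^-1 - r') ^+ 2 + 2%:R * (- 3%:R^-1 - r') + 3%:R = 3%:R * r' ^+ 2 - 3%:R^-1 + 3%:R :> L by field.
  by rewrite hr'; field; rewrite ?n9 ?n3.
Qed.

(** By [roots_pow1] the condition on a and b holds in L exactly when the power k
    of the given root of unity is 1; being a condition on integers, it has the
    same truth value in F. *)
Lemma order_transfer k : exists a b : int, 
  [/\ forall (V : zmodType) (u : nat -> V),
    (forall n, u n.+2 *+ 3 + u n.+1 *+ 2 + u n *+ 3 = 0) ->
    u k *+ (3 ^ k)%N = u 1%N *~ a + u 0%N *~ b &
    (q.+1 %| k)%N <-> (a%:~R = 0 :> F /\ b%:~R = (3 ^ k)%N%:R :> F)].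
Proof.
have [a [b H]] := recurrence_int k; exists a, b; split=> //.
have n3 : 3%:R != 0 :> L by rewrite -natr_eq0_transfer three_neq0.
have [x [x' [px xx xnx rx rx']]] := root_in_L.
have := roots_pow1 H n3 xnx rx rx'.
have x'k : x ^+ k = 1 -> x' ^+ k = 1.
  by move=> E; rewrite -[LHS]mul1r -E -exprMn xx expr1n.
have -> : (a%:~R = 0 :> F /\ b%:~R = (3 ^ k)%N%:R :> F) <-> (a%:~R = 0 :> L /\ b%:~R = (3 ^ k)%N%:R :> L).
  have E (n : int) : n%:~R = 0 :> F <-> n%:~R = 0 :> L.
    by split=> /eqP h; apply/eqP; [rewrite -intr_eq0_transfer | rewrite intr_eq0_transfer].
  have E' : (b%:~R = (3 ^ k)%N%:R :> F) <-> (b%:~R = (3 ^ k)%N%:R :> L).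
    have T (K : pzRingType) : (b%:~R = (3 ^ k)%N%:R :> K) <-> ((b - (3 ^ k)%N%:Z)%:~R = 0 :> K).
      by rewrite mulrzBr; split=> [->|/eqP]; [apply/eqP; rewrite subr_eq0 | rewrite subr_eq0 => /eqP].
    by rewrite !T E.
  by rewrite E E'.
move=> <-; rewrite (prim_order_dvd px); split=> [/eqP xk|[-> _]//].
by split=> //; apply: x'k.
Qed.

(** Otherwise 3 X^2 + 2 X + 3 would have its roots in F, where their power q - 1
    is 1; by [order_transfer], q + 1 would divide q - 1. *)
Lemma m1_nonsquare (i : F) : i ^+ 2 != -1.
Proof.
apply/eqP=> hi; have q5 := q_gt5.
have n3 := three_neq0; have n2 := two_neq0.
have n9 : 9%:R != 0 :> F by rewrite (natrM F 3 3) mulf_neq0.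
have [a [b [H E]]] := order_transfer (q - 1).
have l0 : l != 0 by apply: contra_eq_neq hl => ->; rewrite expr0n mulr0 eq_sym oner_eq0.
have i0 : i != 0 by apply: contra_eq_neq hi => ->; rewrite expr0n /= eq_sym oppr_eq0 oner_eq0.
pose s := 4%:R * l / 3%:R; pose y := - 3%:R^-1 + i * s; pose y' := - 3%:R^-1 - i * s.
have is2 : (i * s) ^+ 2 = - (8%:R / 9%:R).
  have -> : (i * s) ^+ 2 = i ^+ 2 * (2%:R * l ^+ 2) * (8%:R / 9%:R) by rewrite /s; field; rewrite ?n9 ?n3.
  by rewrite hi hl; ring.
have ry : 3%:R * y ^+ 2 + 2%:R * y + 3%:R = 0.
  have -> : 3%:R * y ^+ 2 + 2%:R * y + 3%:R = 3%:R * (i * s) ^+ 2 - 3%:R^-1 + 3%:R by rewrite /y; field.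
  by rewrite is2; field; rewrite ?n9 ?n3.
have ry' : 3%:R * y' ^+ 2 + 2%:R * y' + 3%:R = 0.
  have -> : 3%:R * y' ^+ 2 + 2%:R * y' + 3%:R = 3%:R * (i * s) ^+ 2 - 3%:R^-1 + 3%:R by rewrite /y'; field.
  by rewrite is2; field; rewrite ?n9 ?n3.
have nyy : y != y'.
  rewrite -subr_eq0 /y /y'; have -> : - 3%:R^-1 + i * s - (- 3%:R^-1 - i * s) = 2%:R * 4%:R / 3%:R * i * l :> F by rewrite /s; field.
  by rewrite !mulf_neq0 ?invr_eq0 // (natrM F 2 2) mulf_neq0.
have pw (z : F) : 3%:R * z ^+ 2 + 2%:R * z + 3%:R = 0 -> z ^+ (q - 1) = 1.
  move=> rz; have z0 : z != 0.
    by apply: contraNneq n3 => z0; rewrite -rz z0 expr0n !mulr0 !add0r.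
  apply: (mulIf z0); rewrite mul1r -exprSr -[RHS]expf_card hF; congr (_ ^+ _).
  by clear - q5; lia.
have /E : a%:~R = 0 :> F /\ b%:~R = (3 ^ (q - 1))%N%:R :> F.
  by apply/(roots_pow1 H n3 nyy ry ry'); split; apply: pw.
by move/dvdn_leq => h; clear - q5 h; lia.
Qed.

Lemma rotation_order (c s : nat -> F) :
  c 0%N = 1 -> s 0%N = 0 -> c 1%N = - 3%:R^-1 -> s 1%N != 0 ->
  (forall n, c n.+2 *+ 3 + c n.+1 *+ 2 + c n *+ 3 = 0) ->
  (forall n, s n.+2 *+ 3 + s n.+1 *+ 2 + s n *+ 3 = 0) ->
  forall k, (q.+1 %| k)%N <-> (c k = 1 /\ s k = 0).
Proof.
move=> c0 s0 c1 s1 rc rs k.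
have n3 := three_neq0.
have n3k : (3 ^ k)%:R != 0 :> F by rewrite natrX expf_neq0.
have [a [b [H ->]]] := order_transfer k.
have Es : s k * (3 ^ k)%:R = s 1%N * a%:~R by rewrite mulr_natr (H _ _ rs) s0 mul0rz addr0 mulrzr.
have Ec : c k * (3 ^ k)%:R = c 1%N * a%:~R + b%:~R by rewrite mulr_natr (H _ _ rc) c0 mulrzr.
 split=> [[a0 b0]|[ck sk]].
  split; apply: (mulIf n3k); first by rewrite Ec a0 mulr0 add0r mul1r b0.
  by rewrite Es a0 mulr0 mul0r.
have a0 : a%:~R = 0 :> F.
  by apply/eqP; move/eqP: Es; rewrite sk mul0r eq_sym mulf_eq0 (negPf s1).
by split=> //; move: Ec; rewrite ck a0 mulr0 add0r !mul1r.
Qed.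

End Arith.

(** * Rotations and special orthogonal groups *)

Section Rotations.
Local Open Scope ring_scope.
Variable F : finFieldType.
Local Notation gT := (SL_trinv_sdprod 3 F).
Local Notation inn := (@elt F false).
Hypotheses (nm1 : forall i : F, i ^+ 2 != -1) (n2 : 2%:R != 0 :> F) (n3 : 3%:R != 0 :> F).

Lemma sum_sq_eq0 (x y : F) : x ^+ 2 + y ^+ 2 = 0 -> x = 0 /\ y = 0.
Proof.
move=> E; have [y0|y0] := eqVneq y 0.
  by split=> //; apply/eqP; move: E; rewrite y0 expr0n addr0 => /eqP; rewrite expf_eq0.
have /eqP[] := nm1 (x / y).
by rewrite -[RHS](mulfK (expf_neq0 2 y0)) mulN1r -[X in - X](addKr (x ^+ 2)) E; field.
Qed.

Definition circle : {set F * F} := [set p | p.1 ^+ 2 + p.2 ^+ 2 == 1].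
(** The rotations about the third axis; the point p of the circle consists of
    the cosine and the sine. *)
Definition rotm (p : F * F) : 'M[F]_3 := mx3 p.1 p.2 0 (- p.2) p.1 0 0 0 1.
Definition rotation p : gT := inn (rotm p).

Lemma circleP p : reflect (p.1 ^+ 2 + p.2 ^+ 2 = 1) (p \in circle).
Proof. by rewrite inE; apply: eqP. Qed.

Lemma det_rotm p : p \in circle -> \det (rotm p) = 1.
Proof. by move/circleP=> <-; rewrite det_mx3; ring. Qed.

Lemma mx_rot p : p \in circle -> mx (rotation p) = rotm p.
Proof. by move=> pc; case: (eltP false (det_rotm pc)). Qed.

Lemma outer_rot p : p \in circle -> outer (rotation p) = false.
Proof. by move=> pc; case: (eltP false (det_rotm pc)). Qed.

Lemma rotm_inj : injective rotm.
Proof. by move=> [a b] [c d] /mx3_inj /= [[-> -> _] _ _]. Qed.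

(** Stereographic projection from (-1, 0) embeds the circle in the projective
    line. *)
Lemma card_circle_le : (#|circle| <= #|F|.+1)%N.
Proof.
rewrite -card_option.
pose f (p : F * F) : option F := if p.1 == -1 then None else Some (p.2 / (1 + p.1)).
rewrite -(@card_in_imset _ _ f circle) ?max_card //.
have m1 p : p \in circle -> p.1 = -1 -> p.2 = 0.
  move=> /circleP + E; rewrite E sqrrN expr1n -[RHS]addr0 => /addrI/eqP.
  by rewrite expf_eq0 => /eqP.
move=> [a b] [c d] pc qc; rewrite /f /=.
case: eqP => [a1|/eqP a1]; case: eqP => [c1|/eqP c1] //.
  by rewrite a1 c1 (m1 _ pc a1 : b = 0) (m1 _ qc c1 : d = 0).
have na : 1 + a != 0 by rewrite addrC addr_eq0.
have nc : 1 + c != 0 by rewrite addrC addr_eq0.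
case=> E; move/circleP: pc; move/circleP: qc => /= qc pc.
have Eb : b = d / (1 + c) * (1 + a) by rewrite -E divfK.
have aE : (1 - a) / (1 + a) = (1 - c) / (1 + c).
  have -> : (1 - a) / (1 + a) = (b / (1 + a)) ^+ 2 by rewrite expr_div_n (_ : b ^+ 2 = 1 - a ^+ 2); [field | rewrite -pc; ring].
  have -> : (1 - c) / (1 + c) = (d / (1 + c)) ^+ 2 by rewrite expr_div_n (_ : d ^+ 2 = 1 - c ^+ 2); [field | rewrite -qc; ring].
  by rewrite E.
have ac : a = c.
  have : 2%:R / (1 + a) = 2%:R / (1 + c).
    have -> : 2%:R / (1 + a) = (1 - a) / (1 + a) + 1 by field.
    by rewrite aE; field.
  by move/(mulfI n2)/invr_inj/addrI.
by rewrite Eb ac divfK.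
Qed.

Variable d : F.
Hypothesis d0 : d != 0.
(** The Gram matrix of d (x^2 + y^2) + z^2; the string uses d = 1 and d = -1. *)
Definition gram : 'M[F]_3 := mx3 d 0 0 0 d 0 0 0 1.
Definition SO : {set gT} := [set g | ~~ outer g & (mx g)^T *m gram *m mx g == gram].

Lemma SOP g : reflect (outer g = false /\ (mx g)^T *m gram *m mx g = gram) (g \in SO).
Proof. by rewrite inE; apply: (iffP andP) => [[/negbTE-> /eqP->]|[-> ->]]. Qed.

Lemma SO_group_set : group_set SO.
Proof.
apply/group_setP; split.
  by apply/SOP; rewrite outer1 mx1 trmx1 mul1mx mulmx1.
move=> g h /SOP[og Eg] /SOP[oh Eh]; apply/SOP; rewrite outerM mxM og oh; split=> //.
by rewrite trmx_mul !mulmxA -(mulmxA _ _ gram) -(mulmxA _ _ (mx g)) Eg Eh.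
Qed.
Canonical SO_group := Group SO_group_set.

Lemma rotation_SO p : p \in circle -> rotation p \in SO.
Proof.
move=> pc; apply/SOP; rewrite outer_rot ?mx_rot //; split=> //.
move/circleP: pc => E; rewrite tr_mx3 !mul_mx3.
have E' : d = d * (p.1 ^+ 2 + p.2 ^+ 2) by rewrite E mulr1.
by apply: eq_mx3; first [ring | rewrite [RHS]E'; ring].
Qed.

(** The image of the pole (0, 0, 1) under [g], with its height z put first. *)
Definition pole_col (g : gT) : F * (F * F) := (mx g o2 o2, (mx g o0 o2, mx g o1 o2)).

Lemma SO_fix_pole g : g \in SO -> pole_col g = (1, (0, 0)) ->
  exists2 p, p \in circle & g = rotation p.
Proof.
case/SOP=> og; have := det_mx g; rewrite /pole_col.
have : g = inn (mx g) by rewrite -og eltK.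
have [a [b [x [c [e [y [u [v [z ->]]]]]]]]] := mx3P (mx g).
move=> gE dt; rewrite tr_mx3 !mul_mx3 => /mx3_inj[[E1 _ E3] [E4 E5 E6] _].
rewrite !mxE /= => -[z1 x0 y0].
have u0 : u = 0 by rewrite -[RHS]E3 z1 x0 y0; ring.
have v0 : v = 0 by rewrite -[RHS]E6 z1 x0 y0; ring.
have E1' : a ^+ 2 + c ^+ 2 = 1.
  by apply: (mulfI d0); rewrite mulr1 -[RHS]E1 u0; ring.
have E4' : a * b + c * e = 0.
  by apply: (mulfI d0); rewrite mulr0 -[RHS]E4 u0 v0; ring.
have dt' : a * e - b * c = 1 by rewrite -[RHS]dt det_mx3 u0 v0 z1 x0 y0; ring.
have ea : e = a.
  transitivity (e * (a ^+ 2 + c ^+ 2)); first by rewrite E1' mulr1.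
  transitivity (a * (a * e - b * c) + c * (a * b + c * e)); first by ring.
  by rewrite dt' E4' mulr1 mulr0 addr0.
have cb : c = - b.
  transitivity (c * (a * e - b * c)); first by rewrite dt' mulr1.
  transitivity (- b * (a ^+ 2 + c ^+ 2) + a * (a * b + c * e)); first by ring.
  by rewrite E1' E4' mulr1 mulr0 addr0.
exists (a, b); first by apply/circleP; rewrite /= -E1' cb sqrrN.
by rewrite gE /rotation /rotm /= z1 x0 y0 u0 v0 ea cb.
Qed.

Lemma rotM p g : p \in circle -> outer g = false ->
  pole_col (rotation p * g)%g = ((pole_col g).1,
     (p.1 * (pole_col g).2.1 + p.2 * (pole_col g).2.2,
      - p.2 * (pole_col g).2.1 + p.1 * (pole_col g).2.2)).
Proof.
move=> pc og; rewrite /pole_col !mxM og mx_rot //.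
have [a [b [x [c [e [y [u [v [z ->]]]]]]]]] := mx3P (mx g).
by rewrite mul_mx3 !mxE /= !mul0r !addr0 ?add0r mul1r.
Qed.

Lemma mulrot p g : p \in circle -> pole_col (g * rotation p)%g = pole_col g.
Proof.
move=> pc; rewrite /pole_col !mxM outer_rot // mx_rot //.
have [a [b [x [c [e [y [u [v [z ->]]]]]]]]] := mx3P (mx g).
by rewrite mul_mx3 !mxE /= !mulr0 !add0r !mulr1.
Qed.

Lemma pole_col_rotM p g p' : p \in circle -> p' \in circle -> outer g = false ->
  pole_col (rotation p * (g * rotation p'))%g = ((pole_col g).1,
     (p.1 * (pole_col g).2.1 + p.2 * (pole_col g).2.2,
      - p.2 * (pole_col g).2.1 + p.1 * (pole_col g).2.2)).
Proof. by move=> pc pc' og; rewrite rotM // ?mulrot // outerM og outer_rot. Qed.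

Definition sphere : {set F * (F * F)} :=
  [set v | d * (v.2.1 ^+ 2 + v.2.2 ^+ 2) + v.1 ^+ 2 == 1].

Lemma pole_col_sphere g : g \in SO -> pole_col g \in sphere.
Proof.
case/SOP=> og; rewrite inE /pole_col /=.
have [a [b [x [c [e [y [u [v [z ->]]]]]]]]] := mx3P (mx g).
rewrite tr_mx3 !mul_mx3 => /mx3_inj[_ _ [_ _ E]]; rewrite !mxE /=.
by apply/eqP; rewrite -[RHS]E; ring.
Qed.

(** With [circle_free]: on the vectors of given nonzero norm in the plane, the
    rotations act simply transitively. *)
Lemma circle_trans (x y x' y' D : F) : D != 0 -> x ^+ 2 + y ^+ 2 = D -> x' ^+ 2 + y' ^+ 2 = D ->
  exists2 p, p \in circle & (x', y') = (p.1 * x + p.2 * y, - p.2 * x + p.1 * y).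
Proof.
move=> D0 E E'; exists ((x * x' + y * y') / D, (y * x' - x * y') / D) => /=.
  apply/circleP => /=.
  transitivity ((x ^+ 2 + y ^+ 2) * (x' ^+ 2 + y' ^+ 2) / (D * D)); first by field.
  by rewrite E E' divff ?mulf_neq0.
congr pair.
  by transitivity (x' * (x ^+ 2 + y ^+ 2) / D); [rewrite E mulfK | field].
by transitivity (y' * (x ^+ 2 + y ^+ 2) / D); [rewrite E mulfK | field].
Qed.

Lemma circle_free (x y : F) p p' : x ^+ 2 + y ^+ 2 != 0 ->
  p.1 * x + p.2 * y = p'.1 * x + p'.2 * y -> - p.2 * x + p.1 * y = - p'.2 * x + p'.1 * y -> p = p'.
Proof.
move=> D0 E1 E2; case: p p' E1 E2 => [a b] [a' b'] /= E1 E2.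
have Ea : a * (x ^+ 2 + y ^+ 2) = a' * (x ^+ 2 + y ^+ 2).
  have -> : a * (x ^+ 2 + y ^+ 2) = (a * x + b * y) * x + (- b * x + a * y) * y by ring.
  by rewrite E1 E2; ring.
have Eb : b * (x ^+ 2 + y ^+ 2) = b' * (x ^+ 2 + y ^+ 2).
  have -> : b * (x ^+ 2 + y ^+ 2) = (a * x + b * y) * y - (- b * x + a * y) * x by ring.
  by rewrite E1 E2; ring.
by rewrite (mulIf D0 Ea) (mulIf D0 Eb).
Qed.

(** Each height other than 1 and -1 carries at most one orbit of rotations; at
    the heights 1 and -1 only the poles occur, since the plane is anisotropic. *)
Lemma card_sphere : (#|sphere| <= (#|F| - 2) * #|circle| + 2)%N.
Proof.
pose P z (w : F * F) := d * (w.1 ^+ 2 + w.2 ^+ 2) + z ^+ 2 == 1.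
have -> : #|sphere| = (\sum_z #|[set w | P z w]|)%N.
  rewrite -sum1_card.
  under [RHS]eq_bigr do rewrite -sum1_card.
  rewrite pair_big_dep /=; apply: eq_bigl => -[z w]; by rewrite !inE.
have n11 : (1 : F) != -1 by rewrite -subr_eq0 opprK.
have le1 z : z ^+ 2 = 1 -> (#|[set w | P z w]| <= 1)%N.
  move=> z1; rewrite -(cards1 (0 : F, 0 : F)); apply: subset_leq_card.
  apply/subsetP=> -[x y]; rewrite !inE /P /= z1 -subr_eq0 addrK mulf_eq0 (negPf d0) /=.
  by move/eqP/sum_sq_eq0 => [-> ->].
have le2 z : (z != 1) && (z != -1) -> (#|[set w | P z w]| <= #|circle|)%N.
  case/andP=> z1 z2; have [->|[[x y]]] := set_0Vmem [set w | P z w]; first by rewrite cards0.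
  rewrite inE /P /= => /eqP E.
  have D0 : x ^+ 2 + y ^+ 2 != 0.
    apply/negP=> /eqP D0; move/eqP: E; rewrite D0 mulr0 add0r sqrf_eq1.
    by rewrite (negPf z1) (negPf z2).
  apply: leq_trans (leq_imset_card (fun p => (p.1 * x + p.2 * y, - p.2 * x + p.1 * y)) _).
  apply: subset_leq_card; apply/subsetP=> -[x' y']; rewrite inE /P /= => /eqP E'.
  have DD : x' ^+ 2 + y' ^+ 2 = x ^+ 2 + y ^+ 2.
    by apply: (mulfI d0); apply: (addIr (z ^+ 2)); rewrite E'.
  by have [p pc ->] := circle_trans D0 erefl DD; apply: imset_f.
rewrite (bigD1 1) //= (bigD1 (-1)) 1?eq_sym //=.
have -> : ((#|F| - 2) * #|circle|)%N = (\sum_(z : F | (z != 1%R) && (z != (- 1)%R)) #|circle|)%N.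
  rewrite sum_nat_const; congr (_ * _)%N.
  have -> : #|[pred z : F | (z != 1) && (z != -1)]| = #|~: [set (1 : F); -1]|.
    by apply: eq_card => z; rewrite !inE negb_or.
  by rewrite cardsCs setCK cards2 n11.
rewrite addnA addnC leq_add ?leq_sum //.
by rewrite (leq_add (le1 _ _) (le1 _ _)) ?sqrrN ?expr1n.
Qed.

(** Isometries with the same image of the pole differ by a rotation. *)
Lemma card_SO : (#|SO| <= #|sphere| * #|circle|)%N.
Proof.
have -> : #|SO| = (\sum_(v in sphere) #|[set g in SO | pole_col g == v]|)%N.
  rewrite -sum1_card (partition_big pole_col (mem sphere)) /=; last by move=> g; apply: pole_col_sphere.
  by apply: eq_bigr => v _; rewrite -sum1_card; apply: eq_bigl => g; rewrite inE.
rewrite -sum_nat_const; apply: leq_sum => v _.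
have [->|[g]] := set_0Vmem [set g in SO | pole_col g == v]; first by rewrite cards0.
rewrite inE => /andP[gK /eqP gv].
apply: leq_trans (leq_imset_card (fun p => g * rotation p)%g _).
apply: subset_leq_card; apply/subsetP=> h; rewrite inE => /andP[hK /eqP hv].
have kK : (g^-1 * h)%g \in SO by rewrite groupM ?groupV.
have [|p pc E] := @SO_fix_pole (g^-1 * h)%g kK; last first.
  by apply/imsetP; exists p; rewrite // -E mulKVg.
move: (g^-1 * h)%g kK (mulKVg g h) => k /SOP[ok _] E.
have Ec : col o2 (mx k) = delta_mx o2 0.
  have uk := mx_unit g; rewrite -[LHS](mulKmx uk) -[RHS](mulKmx uk); congr (_ *m _).
  have -> : mx g *m col o2 (mx k) = col o2 (mx h) by rewrite !colE mulmxA -E mxM ok.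
  move: gv hv => <- [h1 h2 h3]; rewrite -colE; apply/colP.
  by elim/ord3P; rewrite [LHS]mxE [RHS]mxE.
by rewrite /pole_col; have E' i := congr1 (fun v => fun_of_matrix v i 0) Ec;
   move: (E' o0) (E' o1) (E' o2); rewrite !mxE /= => -> -> ->.
Qed.

(** Conjugating by [s] a rotation of cosine c gives an isometry that takes the
    pole to height 1/4 + 3c/4.  Multiplying these on both sides by rotations
    yields more than half of the special orthogonal group, as counted by
    [card_SO] and [card_sphere]; a subgroup of index less than 2 is the whole
    group. *)
Lemma SO_gen (s : gT) (H : {group gT}) : s \in SO -> mx s o2 o2 = - 2%:R^-1 ->
  #|circle| = #|F|.+1 ->
  {in circle, forall p, rotation p \in H} -> {in circle, forall p, (rotation p ^ s)%g \in H} ->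
  SO \subset H.
Proof.
move=> sK sz cc HT Hs.
have [os Es] := SOP _ sK.
have q1 := finNzRing_gt1 F.
have n11 : (1 : F) != -1 by rewrite -subr_eq0 opprK.
have n4 : 4%:R != 0 :> F by rewrite (natrM F 2 2) mulf_neq0.
(* C2 consists of the cosines of the rotations of order greater than 2; C
   adds the half turn and drops the one cosine whose conjugated rotation may
   carry the pole to its antipode, since 1/4 + 3c/4 = -1 at c = -5/3. *)
pose C2 : {set F} := [set p.1 | p in circle :\ ((1, 0)%R : F * F) :\ ((-1, 0)%R : F * F)].
pose C : {set F} := (-1 |: C2) :\ (- (5%:R / 3%:R)).
have pc (c : F) : c \in C -> exists s, (c, s) \in circle.
  case/setD1P=> _ /setU1P[->|/imsetP[[a b]]].
    by exists 0; apply/circleP; rewrite /= sqrrN; ring.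
  by rewrite !inE => /and3P[_ _ H'] ->; exists b; rewrite inE.
have C1 c : c \in C -> c != 1.
  case/setD1P=> _ /setU1P[->|/imsetP[[a b]]]; first by rewrite eq_sym.
  rewrite !inE => /and3P[_ + H'] -> /=; apply: contra => /eqP a1.
  move/eqP: H'; rewrite /= a1 expr1n -[RHS]addr0 => /addrI/eqP.
  by rewrite expf_eq0 /= => /eqP ->.
have cardC : (#|F| <= 2 * #|C| + 1)%N.
  have c1 : (1, 0) \in circle by apply/circleP; rewrite /=; ring.
  have c2 : (-1, 0) \in circle :\ ((1, 0)%R : F * F).
    by rewrite !inE /= sqrrN expr1n expr0n addr0 eqxx andbT xpair_eqE eq_sym (negPf n11).
  have m1 : -1 \notin C2.
    apply/imsetP=> -[[a b]]; rewrite !inE /= => /and3P[+ _ /eqP E] a1.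
    move: E; rewrite xpair_eqE -a1 eqxx /= sqrrN expr1n => E; case/negP.
    by move/eqP: E; rewrite -subr_eq0 addrAC subrr add0r expf_eq0.
  have le2 : (#|circle :\ ((1, 0)%R : F * F) :\ ((-1, 0)%R : F * F)| <= #|C2| * 2)%N.
    pose h (p : F * F) := (p.1, p.2 == odflt 0 [pick s | (p.1, s) \in circle]).
    rewrite -card_bool -cardsT -cardsX -(@card_in_imset _ _ h).
      apply: subset_leq_card; apply/subsetP=> _ /imsetP[p pc' ->]; rewrite in_setX inE andbT.
      exact: imset_f.
    move=> [a b] [a' b'] /setD1P[_ /setD1P[_ bc]] /setD1P[_ /setD1P[_ bc']] [aa].
    rewrite -aa in bc' *; case: pickP => [t tc|/(_ b)]; last by rewrite bc.
    rewrite /=; have sq y : (a, y) \in circle -> (y == t) || (y == - t).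
      rewrite -eqf_sqr => /circleP; move/circleP: tc => /= <- /addrI ->.
      exact: eqxx.
    by case/orP: (sq _ bc) => /eqP->; case/orP: (sq _ bc') => /eqP->; rewrite ?eqxx => //;
      try (case: eqP => // -> //); move=> /esym/eqP // ->.
  have := cardsD1 ((1, 0) : F * F) circle; rewrite c1 (cardsD1 ((-1, 0) : F * F) (circle :\ _)) c2 cc => E.
  have := cardsD1 (- (5%:R / 3%:R)) (-1 |: C2); rewrite -/C cardsU1 m1.
  set b := (X in (nat_of_bool X + #|C|)%N); clearbody b.
  move: le2 E; move: #|C| #|C2| #|F| #|circle :\ _ :\ _| => nC nC2 nF nc.
  by case: b => /= h1 h2 h3; clear - h1 h2 h3; lia.
pose sn c : F := odflt 0 [pick s | (c, s) \in circle].
have snP c : c \in C -> (c, sn c) \in circle.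
  by move/pc=> [t tc]; rewrite /sn; case: pickP => // /(_ t); rewrite tc.
pose w c := (rotation (c, sn c) ^ s)%g.
have wK c : c \in C -> w c \in SO.
  by move=> cC; rewrite /w groupJ ?rotation_SO ?snP.
have wz c : c \in C -> (pole_col (w c)).1 = 4%:R^-1 + 3%:R / 4%:R * c.
  move=> cC; have oR := outer_rot (snP c cC).
  have [ow _] := SOP _ (wK c cC).
  have sw : mx s *m mx (w c) = rotm (c, sn c) *m mx s.
    have := congr1 (@mx F) (conjgC (rotation (c, sn c)) s).
    by rewrite -/(w c) !mxM os ow mx_rot // snP.
  have -> : (pole_col (w c)).1 = (gram *m mx (w c)) o2 o2.
    rewrite /pole_col /gram.
    have [? [? [? [? [? [? [? [? [z ->]]]]]]]]] := mx3P (mx (w c)).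
    by rewrite mul_mx3 !mxE /=; ring.
  rewrite -{1}Es -(mulmxA _ (mx s)) sw.
  have := sz; have := Es; rewrite /gram /rotm /=.
  have [a [b [x [e [f [y [g [h [z ->]]]]]]]]] := mx3P (mx s).
  rewrite tr_mx3 !mul_mx3 => /mx3_inj[_ _ [_ _ E]]; rewrite !mxE /= => z2.
  have E' : d * (x ^+ 2 + y ^+ 2) = 1 - z ^+ 2 by rewrite -[X in X - _]E; ring.
  transitivity (c * (d * (x ^+ 2 + y ^+ 2)) + z ^+ 2); first by ring.
  by rewrite E' z2; field; rewrite n4 n2.
have wH c : c \in C -> w c \in H by move/snP/Hs.
clearbody w.
(* Products p w(c) p' are pairwise distinct: the height of the image of the
   pole gives c, its longitude gives p, and then p' is determined. *)
pose f (x : F * ((F * F) * (F * F))) : gT := (rotation x.2.1 * (w x.1 * rotation x.2.2))%g.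
pose X := setX C (setX circle circle).
have f_inj : {in X &, injective f}.
  move=> [c [p p']] [c' [r r']]; case/setXP=> /= cC /setXP[/= pC p'C] /setXP[/= c'C /setXP[/= rC r'C]].
  have [ow _] := SOP _ (wK c cC); have [ow' _] := SOP _ (wK c' c'C).
  rewrite /f /= => E; have e := congr1 pole_col E.
  rewrite (pole_col_rotM pC p'C ow) (pole_col_rotM rC r'C ow') in e.
  have e1 : (pole_col (w c)).1 = (pole_col (w c')).1 := congr1 fst e.
  move: e1; rewrite (wz c cC) (wz c' c'C) => /addrI/(mulfI (mulf_neq0 n3 (invr_neq0 n4))) cc'.
  rewrite -{c' c'C ow'}cc' in e E *.
  move: (pole_col (w c)) (wz c cC) (pole_col_sphere (wK c cC)) e => v vz vS e.
  have E1 := congr1 (fun x => x.2.1) e; have E2 := congr1 (fun x => x.2.2) e.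
  have D0 : v.2.1 ^+ 2 + v.2.2 ^+ 2 != 0.
    apply/negP=> /eqP D0; move: vS; rewrite inE D0 mulr0 add0r vz sqrf_eq1.
    case/orP=> /eqP wc.
      case/eqP: (C1 c cC); apply: (mulfI (mulf_neq0 n3 (invr_neq0 n4))); apply: (addrI 4%:R^-1).
      by rewrite wc; field.
    case/setD1P: cC => /eqP[]; apply: (mulfI (mulf_neq0 n3 (invr_neq0 n4))); apply: (addrI 4%:R^-1).
    by rewrite wc; field; rewrite n4 n3.
  have pr := circle_free D0 E1 E2; rewrite -pr in E *.
  have {}E := mulgI _ _ _ E; have {}E := mulgI _ _ _ E.
  have := congr1 (@mx F) E; rewrite !mx_rot // => /rotm_inj -> //.
have sub : f @: X \subset SO :&: H.
  apply/subsetP=> y /imsetP[[c [p p']] xX ->]; case/setXP: xX => /= cC /setXP[/= pC p'C].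
  by rewrite /f /= inE !groupM ?rotation_SO ?wK ?HT ?wH.
have leH : (#|C| * (#|F|.+1 * #|F|.+1) <= #|(SO :&: H)%G|)%N.
  by rewrite -cc -!cardsX -(card_in_imset f_inj) subset_leq_card.
have leK : (#|SO| <= ((#|F| - 2) * #|F|.+1 + 2) * #|F|.+1)%N.
  by rewrite -cc (leq_trans card_SO) // leq_mul2r card_sphere orbT.
have : (#|SO_group : SO :&: H| == 1)%N.
  have L := Lagrange (subsetIl SO_group H).
  move: leH leK; rewrite /= -L; set i := #|_ : _|; set h := #|_ :&: _|.
  have : (0 < i)%N by apply: indexg_gt0.
  move: cardC q1; move: (#|F|) (#|C|) => n m.
  case: i => [|[|i]] // le1 n1 _ le2 le3; exfalso.
  have h1 : ((n - 1) * (n.+1 * n.+1) <= 2 * h)%N.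
    apply: leq_trans (leq_mul (leqnn 2) le2); rewrite (mulnA 2) leq_mul2r; clear - le1 n1; lia.
  have h2 : (2 * h <= h * i.+2)%N by rewrite mulnC leq_mul2l orbT.
  have := leq_trans h1 (leq_trans h2 le3).
  rewrite mulnA leq_mul2r /=; clear - n1; case: n n1 => [|[|n]] // _; nia.
by rewrite indexg_eq1 subsetI => /andP[].
Qed.

End Rotations.

(** * Two special orthogonal groups generate SL_3 *)

Section Generation.
Local Open Scope ring_scope.
Variable F : finFieldType.
Local Notation gT := (SL_trinv_sdprod 3 F).
Local Notation inn := (@elt F false).
Hypotheses (nm1 : forall i : F, i ^+ 2 != -1) (n2 : 2%:R != 0 :> F) (n3 : 3%:R != 0 :> F).
Variable H : {group gT}.
Hypotheses (H1 : SO (1 : F) \subset H) (Hm1 : SO (-1 : F) \subset H).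

Lemma SO_in (d : F) (A : 'M[F]_3) : SO d \subset H -> \det A = 1 ->
  A^T *m gram d *m A = gram d -> inn A \in H.
Proof.
move=> sub dA E; apply: (subsetP sub); apply/SOP.
by have [-> ->] := eltP false dA.
Qed.

Lemma inn_conj (A B C B' : 'M[F]_3) : inn B \in H -> \det A = 1 -> \det B = 1 -> B' *m B = 1%:M ->
  B *m A *m B' = C -> inn A \in H -> inn C \in H.
Proof.
move=> hB dA dB BB <- hA.
have dB' : \det B' = 1 by rewrite -(mulr1 (\det B')) -dB -det_mulmx BB det1.
have B'E : (inn B)^-1%g = inn B'.
  by apply/eqP; rewrite eq_invg_mul eltMi // (mulmx1C BB) elt1.
by rewrite -!eltMi ?det_mulmx ?dA ?dB ?mulr1 // -B'E !groupM ?groupV.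
Qed.

Definition root_in i j a := inn (elem i j a) \in H.

(** Monomial isometries of x^2 + y^2 + z^2 permute the root subgroups: P is a
    cyclic permutation of the axes, and Q exchanges the first two and reverses
    the third. *)
Lemma root_cycle a :
  [/\ root_in o0 o1 a -> root_in o1 o2 a, root_in o1 o2 a -> root_in o2 o0 a,
      root_in o2 o0 a -> root_in o0 o1 a & root_in o0 o1 a <-> root_in o1 o0 a] /\
  [/\ root_in o1 o0 a -> root_in o2 o1 a, root_in o2 o1 a -> root_in o0 o2 a &
      root_in o0 o2 a -> root_in o1 o0 a].
Proof.
pose P : 'M[F]_3 := mx3 0 0 1 1 0 0 0 1 0.
pose Q : 'M[F]_3 := mx3 0 1 0 1 0 0 0 0 (-1).
have dP : \det P = 1 by rewrite det_mx3; ring.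
have dQ : \det Q = 1 by rewrite det_mx3; ring.
have hP : inn P \in H.
  by apply: (SO_in H1 dP); rewrite tr_mx3 !mul_mx3; apply: eq_mx3; ring.
have hQ : inn Q \in H.
  by apply: (SO_in H1 dQ); rewrite tr_mx3 !mul_mx3; apply: eq_mx3; ring.
have PP : P^T *m P = 1%:M by rewrite tr_mx3 !mul_mx3 scalar_mx3; apply: eq_mx3; ring.
have QQ : Q^T *m Q = 1%:M by rewrite tr_mx3 !mul_mx3 scalar_mx3; apply: eq_mx3; ring.
have cP i j i' j' : i != j -> P *m elem i j a *m P^T = elem i' j' a ->
    root_in i j a -> root_in i' j' a.
  by move=> ij; apply: inn_conj => //; apply: det_elem.
have cQ i j i' j' : i != j -> Q *m elem i j a *m Q^T = elem i' j' a ->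
    root_in i j a -> root_in i' j' a.
  by move=> ij; apply: inn_conj => //; apply: det_elem.
split; split; try (by apply: cP => //; rewrite /P tr_mx3 !elemE /= !mul_mx3; apply: eq_mx3; ring).
by split; apply: cQ => //; rewrite /Q tr_mx3 !elemE /= !mul_mx3; apply: eq_mx3; ring.
Qed.

Lemma pairs_connected (P : 'I_3 -> 'I_3 -> Prop) :
  [/\ P o0 o1 -> P o1 o2, P o1 o2 -> P o2 o0, P o2 o0 -> P o0 o1 & P o0 o1 <-> P o1 o0] /\
  [/\ P o1 o0 -> P o2 o1, P o2 o1 -> P o0 o2 & P o0 o2 -> P o1 o0] ->
  forall i j i' j', i != j -> P i j -> i' != j' -> P i' j'.
Proof.
case=> [[c1 c2 c3 [c4 c4']] [c5 c6 c7]].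
by elim/ord3P; elim/ord3P; elim/ord3P; elim/ord3P => //= _; auto 10.
Qed.

(** Since the six root subgroups are conjugate, one and the same set of
    parameters, a subring of F, describes the elementary matrices in [H]. *)
Definition full a := forall i j, i != j -> root_in i j a.

Lemma root_full i j a : i != j -> root_in i j a -> full a.
Proof.
by move=> ij h i' j'; apply: (@pairs_connected (fun x y => root_in x y a) (root_cycle a) i j).
Qed.

Lemma fullD a b : full a -> full b -> full (a + b).
Proof.
move=> fa fb i j ij; rewrite /root_in -elemD // -eltMi ?det_elem //.
by apply: groupM; [exact: fa | exact: fb].
Qed.

Lemma fullN a : full a -> full (- a).
Proof. by move=> fa i j ij; rewrite /root_in -elt_elemV // groupV; apply: fa. Qed.

Lemma fullM a b : full a -> full b -> full (a * b).
Proof.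
move=> fa fb i j ij; have [k jk ki] := elem_third ij.
have ik : i != k by rewrite eq_sym.
have kj : k != j by rewrite eq_sym.
rewrite /root_in -(elem_comm _ _ ij jk ki) -!eltMi ?det_mulmx ?det_elem ?mulr1 //.
by do ![apply: groupM]; [exact: fa | exact: fb | exact: fullN | exact: fullN].
Qed.

(** The hyperbolic rotations of the last two coordinates, isometries of
    -x^2 - y^2 + z^2. *)
Definition hypm (C S : F) : 'M[F]_3 := mx3 1 0 0 0 C S 0 S C.

Lemma det_hypm C S : C ^+ 2 - S ^+ 2 = 1 -> \det (hypm C S) = 1.
Proof. by move=> E; rewrite det_mx3 -[RHS]E; ring. Qed.

Lemma hypm_in C S : C ^+ 2 - S ^+ 2 = 1 -> inn (hypm C S) \in H.
Proof.
move=> E; apply: (SO_in Hm1 (det_hypm E)); rewrite tr_mx3 !mul_mx3.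
by apply: eq_mx3; first [by ring | by rewrite -[RHS]E; ring
  | by transitivity (- (C ^+ 2 - S ^+ 2)); [ring | rewrite E]].
Qed.

Lemma hypm_inv C S : C ^+ 2 - S ^+ 2 = 1 -> hypm C (- S) *m hypm C S = 1%:M.
Proof.
move=> E; rewrite mul_mx3 scalar_mx3.
by apply: eq_mx3; first [ring | rewrite -[RHS]E; ring].
Qed.

Lemma five_neq0 : 5%:R != 0 :> F.
Proof.
apply: contra (nm1 2%:R) => E; rewrite -subr_eq0.
by have -> : 2%:R ^+ 2 - -1 = 5%:R :> F by ring.
Qed.

Lemma seventeen_neq0 : 17%:R != 0 :> F.
Proof.
apply: contra (nm1 4%:R) => E; rewrite -subr_eq0.
by have -> : 4%:R ^+ 2 - -1 = 17%:R :> F by ring.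
Qed.

Lemma full_start : full (30%:R / 17%:R).
Proof.
have n5 := five_neq0; have n17 := seventeen_neq0.
have n4 : 4%:R != 0 :> F by rewrite (natrM F 2 2) mulf_neq0.
have n8 : 8%:R != 0 :> F by rewrite (natrM F 2 4) mulf_neq0.
pose R : 'M[F]_3 := mx3 1 0 0 0 (8%:R / 17%:R) (15%:R / 17%:R) 0 (- (15%:R / 17%:R)) (8%:R / 17%:R).
have dR : \det R = 1 by rewrite det_mx3; field; rewrite n17.
have hR : inn R \in H.
  by apply: (SO_in H1 dR); rewrite tr_mx3 !mul_mx3; apply: eq_mx3; field; rewrite ?n17.
(* The product of the Euclidean rotation and the hyperbolic one is a
   transvection fixing the vector with coordinates 5 and -3 in the last two
   coordinates; a hyperbolic rotation brings that vector to the y-axis. *)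
have E1 : (17%:R / 8%:R) ^+ 2 - (15%:R / 8%:R) ^+ 2 = 1 :> F by field; rewrite n8.
have E2 : (5%:R / 4%:R) ^+ 2 - (3%:R / 4%:R) ^+ 2 = 1 :> F by field; rewrite n4.
have E3 : (5%:R / 4%:R) ^+ 2 - (- (3%:R / 4%:R)) ^+ 2 = 1 :> F by rewrite sqrrN.
apply: (@root_full o1 o2) => //.
apply: (@inn_conj (R *m hypm (17%:R / 8%:R) (15%:R / 8%:R)) _ _ _
          (hypm_in E2) _ (det_hypm E2) (hypm_inv E2)).
- by rewrite det_mulmx dR det_hypm // mulr1.
- by rewrite !elemE /= !mul_mx3; apply: eq_mx3; field; rewrite ?n4 ?n8 ?n17.
- by rewrite -eltMi ?det_hypm // (groupM hR (hypm_in E1)).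
Qed.

(** The nonzero parameter of [full_start] has a power equal to 1. *)
Lemma full1 : full 1.
Proof.
pose a : F := 30%:R / 17%:R.
have a0 : a != 0.
  rewrite mulf_neq0 ?invr_eq0 ?seventeen_neq0 // (natrM F 6 5) mulf_neq0 ?five_neq0 //.
  by rewrite (natrM F 2 3) mulf_neq0.
have fX n : full (a ^+ n.+1).
  by elim: n => [|n IH]; [exact: full_start | rewrite exprS; apply: fullM => //; exact: full_start].
have q1 := finNzRing_gt1 F.
have -> : 1 = a ^+ (#|F| - 2).+1.
  apply: (mulIf a0); rewrite mul1r -exprSr -[LHS]expf_card; congr (_ ^+ _).
  by rewrite -addn2 subnK.
exact: fX.
Qed.

(** A hyperbolic rotation with parameters C and S conjugates 1 + E_10 into
    1 + C E_10 + S E_20, and commutators isolate C and S.  Their sum is an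
    arbitrary nonzero element a. *)
Lemma full_all a : full a.
Proof.
have [->|a0] := eqVneq a 0; first by rewrite -(subrr 1); apply: fullD full1 (fullN full1).
pose C := (a + a^-1) / 2%:R; pose S := (a - a^-1) / 2%:R.
have n4 : 4%:R != 0 :> F by rewrite (natrM F 2 2) mulf_neq0.
have E : C ^+ 2 - S ^+ 2 = 1 by rewrite /C /S; field; rewrite ?a0 ?n2 ?n4.
have -> : a = C + S by rewrite /C /S; field; rewrite ?a0 ?n2 ?n4.
pose g : 'M[F]_3 := mx3 1 0 0 C 1 0 S 0 1.
pose g' : 'M[F]_3 := mx3 1 0 0 (- C) 1 0 (- S) 0 1.
have dg : \det g = 1 by rewrite det_mx3; ring.
have dg' : \det g' = 1 by rewrite det_mx3; ring.
have hg : inn g \in H.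
  apply: (@inn_conj (elem o1 o0 1) _ _ _ (hypm_in E) _ (det_hypm E) (hypm_inv E)).
  - exact: det_elem.
  - by rewrite !elemE /= !mul_mx3; apply: eq_mx3; first [by ring | by rewrite -[RHS]E; ring].
  - exact: full1.
have gV : (inn g)^-1%g = inn g'.
  apply/eqP; rewrite eq_invg_mul eltMi // -(elt1 F); apply/eqP; congr (elt _ _).
  by rewrite mul_mx3 scalar_mx3; apply: eq_mx3; ring.
have hg' : inn g' \in H by rewrite -gV groupV.
have com i j x : i != j -> elem i j 1 *m g *m elem i j (-1) *m g' = x -> inn x \in H.
  move=> ij <-; rewrite -!eltMi ?det_mulmx ?det_elem ?dg ?mulr1 //.
  have e1 := full1 ij; have e2 := fullN full1 ij.
  by do ![apply: groupM].
apply: fullD.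
  apply: (@root_full o2 o0) => //; apply: (com o2 o1) => //.
  by rewrite !elemE /= !mul_mx3; apply: eq_mx3; ring.
apply: (@root_full o1 o0) => //; apply: (com o1 o2) => //.
by rewrite !elemE /= !mul_mx3; apply: eq_mx3; ring.
Qed.

Lemma SO_gen_SL g : outer g = false -> g \in H.
Proof. by apply: elem_gen_SL => i j a ij; apply: full_all. Qed.

End Generation.

(** * Dihedral groups and images of strings *)

Section Abstract.
Variable gT : finGroupType.

(** The elements of I in the dihedral group of order at most 8 lie in the
    four-group generated by b and b^a, and b^a is not in K. *)
Lemma dihedral8_cap (a b : gT) (I K : {group gT}) :
  a ^+ 2 = 1 -> b ^+ 2 = 1 -> (a * b) ^+ 4 = 1 ->
  a \notin I -> b \in I -> b ^ a \in I -> K \subset I -> b \in K -> b ^ a \notin K ->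
  <<[set x in [:: a; b]]>> :&: K \subset <[b]>.
Proof.
move=> a2 b2 ab4 aI bI caI sKI bK caK; set c := b ^ a in caI caK.
have aV : a^-1 = a by apply/eqP; rewrite eq_invg_mul -expg2 a2.
have bV : b^-1 = b by apply/eqP; rewrite eq_invg_mul -expg2 b2.
have c2 : c ^+ 2 = 1 by rewrite -conjXg b2 conj1g.
have ca : c ^ a = b by rewrite -conjgM -expg2 a2 conjg1.
have cbc : commute b c.
  have cV : c^-1 = c by apply/eqP; rewrite eq_invg_mul -expg2 c2.
  have bcE : b * c = (b * a) ^+ 2 by rewrite /c conjgE aV expg2 !mulgA.
  have ba : (a * b) ^ a = b * a by rewrite conjgE -mulgA mulKg.
  have : (b * c) ^+ 2 = 1 by rewrite bcE -expgM -ba -conjXg ab4 conj1g.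
  by rewrite expg2 => /eqP; rewrite -eq_invg_mul invMg cV bV => /eqP.
have inv_cycle (x y : gT) : x ^+ 2 = 1 -> y \in <[x]> -> y = 1 \/ y = x.
  move=> x2 /cycleP[n ->]; rewrite -(odd_double_half n) expgD -muln2 mulnC expgM x2 expg1n mulg1.
  by case: (odd n); [right | left].
have Na : <[a]> \subset 'N(<[b]> <*> <[c]>).
  by rewrite cycle_subG inE conjYg -!cycleJ -/c ca joingC.
have sub : <<[set x in [:: a; b]]>> \subset (<[b]> <*> <[c]>) * <[a]>.
  rewrite -norm_joinEr // gen_subG; apply/subsetP=> x; rewrite !inE => /orP[]/eqP->.
    exact: (subsetP (joing_subr _ _)) (cycle_id a).
  by apply: (subsetP (joing_subl _ _)); apply: (subsetP (joing_subl _ _)) (cycle_id b).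
apply/subsetP=> x /setIP[/(subsetP sub)/mulsgP[v e]].
rewrite cent_joinEr; last exact/cents_cycle/commute_sym.
case/mulsgP=> y z yb zc -> ea -> xK {x v}.
have xI := subsetP sKI _ xK.
have yI : y \in I by case: (inv_cycle b y b2 yb) => ->.
have zI : z \in I by case: (inv_cycle c z c2 zc) => ->.
have e1 : e = 1.
  case: (inv_cycle a e a2 ea) => // eE; case/negP: aI.
  by rewrite -eE -(groupMl _ (groupM yI zI)).
rewrite e1 mulg1 in xK *.
have yK : y \in K by case: (inv_cycle b y b2 yb) => ->.
case: (inv_cycle c z c2 zc) => zE; first by rewrite zE mulg1.
by case/negP: caK; rewrite -zE -(groupMl _ yK).
Qed.

Lemma order4 (x : gT) : x ^+ 4 = 1 -> x ^+ 2 != 1 -> #[x] = 4.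
Proof.
move=> x4 x2; have : (#[x] %| 2 ^ 2)%N by rewrite order_dvdn x4.
case/(dvdn_pfactor _ _ (isT : prime 2)) => -[|[|[|//]]] _ E //.
  by move: x2; rewrite -order_dvdn E.
by move: x2; rewrite -order_dvdn E.
Qed.

Lemma subgen_coset n (t : n.-tuple gT) (N : {group gT}) (J : {set 'I_n}) :
  [set: gT] \subset 'N(N) ->
  subgen (map_tuple (coset N) t) J = subgen t J / N.
Proof.
move=> nN; rewrite /subgen quotient_gen; last exact: subset_trans (subsetT _) nN.
congr <<_>>; rewrite quotientE morphimEsub; last exact: subset_trans (subsetT _) nN.
rewrite -imset_comp; apply: eq_imset => j /=; exact: tnth_map.
Qed.

End Abstract.

(** * The string *)

Section Main.
Local Open Scope ring_scope.
Variable F : finFieldType.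
Local Notation gT := (SL_trinv_sdprod 3 F).
Local Notation inn := (@elt F false).
Local Notation out := (@elt F true).
Hypotheses (nm1 : forall i : F, i ^+ 2 != -1) (n2 : 2%:R != 0 :> F) (n3 : 3%:R != 0 :> F).
Variables m al : F.
Hypotheses (hm : m ^+ 2 = 2%:R) (hal : al ^+ 2 = - 3%:R).

Lemma four_neq0 : 4%:R != 0 :> F. Proof. by rewrite (natrM F 2 2) mulf_neq0. Qed.
Lemma nine_neq0 : 9%:R != 0 :> F. Proof. by rewrite (natrM F 3 3) mulf_neq0. Qed.

(** A primitive cube root of unity, [al] being a square root of -3. *)
Definition om : F := (al - 1) / 2%:R.
(** The half turn about the axis (-m, 1, 1), where m^2 = 2: the axis is orthogonal
    to that of [X2] and at 45 degrees to that of [D1]. *)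
Definition S0 : 'M[F]_3 := mx3 0 (- m / 2%:R) (- m / 2%:R)
  (- m / 2%:R) (- 2%:R^-1) 2%:R^-1 (- m / 2%:R) 2%:R^-1 (- 2%:R^-1).
(** The half turn about the first axis. *)
Definition D1 : 'M[F]_3 := mx3 1 0 0 0 (-1) 0 0 0 (-1).
(** The half turn about the axis (1, m, 0), for which the product with [D1] is a
    rotation of cosine -1/3. *)
Definition X2 : 'M[F]_3 := mx3 (- 3%:R^-1) (2%:R * m / 3%:R) 0 (2%:R * m / 3%:R) 3%:R^-1 0 0 0 (-1).
(** The half turn about the axis (0, al, 1) of the form -x^2 - y^2 + z^2, times
    J.  That axis is orthogonal to the axis of [D1] and, for this form, at 45 degrees
    to that of [X2].  The eigenvalues of M3 are 1, om and om^2. *)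
Definition M3 : 'M[F]_3 := mx3 1 0 0 0 (- 2%:R^-1) (al / 2%:R) 0 (al / 2%:R) (- 2%:R^-1).
Definition M3V : 'M[F]_3 := mx3 1 0 0 0 (- 2%:R^-1) (- al / 2%:R) 0 (- al / 2%:R) (- 2%:R^-1).

Ltac fld := by field : hm hal; rewrite ?n2 ?n3 ?four_neq0 ?nine_neq0.

Lemma om3 : om ^+ 3 = 1. Proof. rewrite /om; fld. Qed.

Lemma om_neq0 : om != 0.
Proof. by apply: contra_eq_neq om3 => ->; rewrite expr0n eq_sym oner_eq0. Qed.

Lemma om2_neq1 : om ^+ 2 != 1.
Proof.
apply/eqP=> E; have al3 : al = - 3%:R.
  have -> : al = - 2%:R * om ^+ 2 - 1 by rewrite /om; fld.
  by rewrite E; ring.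
have : 12%:R = 0 :> F by rewrite -[RHS](subrr (al ^+ 2)) {1}al3 hal; ring.
by move/eqP; rewrite (natrM F 4 3) mulf_eq0 (negPf four_neq0) (negPf n3).
Qed.

Lemma mulSS : S0 *m S0 = 1%:M.
Proof. rewrite mul_mx3 scalar_mx3; apply: eq_mx3; fld. Qed.
Lemma mulDD : D1 *m D1 = 1%:M.
Proof. rewrite mul_mx3 scalar_mx3; apply: eq_mx3; fld. Qed.
Lemma mulXX : X2 *m X2 = 1%:M.
Proof. rewrite mul_mx3 scalar_mx3; apply: eq_mx3; fld. Qed.
Lemma mulMMV : M3 *m M3V = 1%:M.
Proof. rewrite mul_mx3 scalar_mx3; apply: eq_mx3; fld. Qed.
Lemma det_S : \det S0 = 1. Proof. rewrite det_mx3; fld. Qed.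
Lemma det_D : \det D1 = 1. Proof. rewrite det_mx3; fld. Qed.
Lemma det_X : \det X2 = 1. Proof. rewrite det_mx3; fld. Qed.
Lemma det_M : \det M3 = 1. Proof. rewrite det_mx3; fld. Qed.
Lemma trS : S0^T = S0. Proof. exact: tr_mx3. Qed.
Lemma trD : D1^T = D1. Proof. exact: tr_mx3. Qed.
Lemma trX : X2^T = X2. Proof. exact: tr_mx3. Qed.
Lemma trM : M3^T = M3. Proof. exact: tr_mx3. Qed.
Lemma SX : S0 *m X2 = X2 *m S0. Proof. rewrite !mul_mx3; apply: eq_mx3; fld. Qed.
Lemma DM : D1 *m M3 = M3 *m D1. Proof. rewrite !mul_mx3; apply: eq_mx3; fld. Qed.
(** This makes t0 and t3 commute; in other words (M3 S0)^2 = om. *)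
Lemma SM : om *: (S0 *m M3) = om ^+ 2 *: (M3V *m S0).
Proof. rewrite !mul_mx3 !scale_mx3 /om; apply: eq_mx3; fld. Qed.


Definition J : 'M[F]_3 := gram (-1).
Definition W : 'M[F]_3 := om *: M3.
Definition t0 : gT := out S0.
Definition t1 : gT := inn D1.
Definition t2 : gT := inn X2.
Definition t3 : gT := out W.
Definition tA : gT := out 1%:M.
Definition tB : gT := out (om *: J).

Lemma gram1 : gram 1 = 1%:M :> 'M[F]_3. Proof. by rewrite scalar_mx3. Qed.
Lemma det_J : \det J = 1. Proof. by rewrite det_mx3; ring. Qed.
Lemma det_omM (A : 'M[F]_3) : \det A = 1 -> \det (om *: A) = 1.
Proof. by move=> dA; rewrite detZ om3 dA mulr1. Qed.
Lemma det_W : \det W = 1. Proof. exact: det_omM det_M. Qed.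
Lemma mulJJ : J *m J = 1%:M.
Proof. by rewrite mul_mx3 scalar_mx3; apply: eq_mx3; ring. Qed.
Lemma trJ : J^T = J. Proof. exact: tr_mx3. Qed.
Lemma JM : J *m M3 = M3V *m J.
Proof. rewrite !mul_mx3; apply: eq_mx3; fld. Qed.

Lemma out_mul b (A A' B : 'M[F]_3) : \det A = 1 -> \det B = 1 -> A^T *m A' = 1%:M ->
  (elt b A * out B)%g = elt (~~ b) (A' *m B).
Proof.
move=> dA dB E; have uA : A^T \in unitmx by rewrite unitmx_tr unitmxE dA unitr1.
have -> : A' = invmx A^T by rewrite -[RHS]mulmx1 -E mulKmx.
by rewrite (eltM b true dA dB); case: b.
Qed.

Lemma trWV : W^T *m (om ^+ 2 *: M3V) = 1%:M.
Proof. rewrite /W !scale_mx3 tr_mx3 mul_mx3 scalar_mx3 /om; apply: eq_mx3; fld. Qed.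

Lemma trBV : (om *: J)^T *m (om ^+ 2 *: J) = 1%:M.
Proof. rewrite !scale_mx3 tr_mx3 mul_mx3 scalar_mx3 /om; apply: eq_mx3; fld. Qed.

Lemma det_1 : \det (1%:M : 'M[F]_3) = 1. Proof. exact: det1. Qed.
Lemma det_B : \det (om *: J) = 1. Proof. exact: det_omM det_J. Qed.

Lemma trSS : S0^T *m S0 = 1%:M. Proof. by rewrite trS mulSS. Qed.
Lemma trDD : D1^T *m D1 = 1%:M. Proof. by rewrite trD mulDD. Qed.
Lemma trXX : X2^T *m X2 = 1%:M. Proof. by rewrite trX mulXX. Qed.

Lemma t0_sqr : (t0 ^+ 2 = 1)%g.
Proof. by rewrite expg2 (out_mul true det_S det_S trSS) mulSS elt1. Qed.
Lemma t1_sqr : (t1 ^+ 2 = 1)%g.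
Proof. by rewrite expg2 (eltMi false det_D det_D) mulDD elt1. Qed.
Lemma t2_sqr : (t2 ^+ 2 = 1)%g.
Proof. by rewrite expg2 (eltMi false det_X det_X) mulXX elt1. Qed.
Lemma t3_sqr : (t3 ^+ 2 = 1)%g.
Proof.
rewrite expg2 (out_mul true det_W det_W trWV) /=.
rewrite -scalemxAl -scalemxAr scalerA mulrC -exprS om3 scale1r.
by rewrite (mulmx1C mulMMV) elt1.
Qed.

Lemma c02 : commute t0 t2.
Proof.
by rewrite /commute (eltMi true det_S det_X) (out_mul false det_X det_S trXX) SX.
Qed.
Lemma c13 : commute t1 t3.
Proof.
rewrite /commute (eltMi true det_W det_D) (out_mul false det_D det_W trDD).
by rewrite /W -scalemxAl -scalemxAr DM.
Qed.
Lemma c03 : commute t0 t3.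
Proof.
rewrite /commute (out_mul true det_S det_W trSS) (out_mul true det_W det_S trWV).
by rewrite /W -scalemxAl -scalemxAr SM.
Qed.

Lemma outer_t0 : outer t0. Proof. by have [->] := eltP true det_S. Qed.
Lemma outer_t3 : outer t3. Proof. by have [->] := eltP true det_W. Qed.
Lemma outer_tA : outer tA. Proof. by have [->] := eltP true det_1. Qed.
Lemma outer_t1 : outer t1 = false. Proof. by have [->] := eltP false det_D. Qed.
Lemma outer_t2 : outer t2 = false. Proof. by have [->] := eltP false det_X. Qed.

(** The matrix X of [g] commutes with t G exactly when X^-T G = G X. *)
Lemma SO_commute (d k : F) g : k != 0 -> \det (k *: gram d) = 1 -> outer g = false ->
  (g \in SO d) <-> commute g (out (k *: gram d)).
Proof.
move=> k0 dG og; have gE : g = inn (mx g) by rewrite -og eltK.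
have dX := det_mx g; have uX : (mx g)^T \in unitmx by rewrite unitmx_tr mx_unit.
have E1 : (g * out (k *: gram d) = out (invmx (mx g)^T *m (k *: gram d)))%g.
  by rewrite {1}gE (out_mul false dX dG (mulmxV uX)).
have E2 : (out (k *: gram d) * g = out (k *: gram d *m mx g))%g.
  by rewrite {1}gE (eltMi true dG dX).
rewrite /commute E1 E2; split=> [/SOP[_ E]|].
  congr (elt _ _); rewrite -scalemxAl -scalemxAr -[in LHS]E -mulmxA mulKmx //.
move/(elt_inj _ _) => E; apply/SOP; split=> //.
have {}E : invmx (mx g)^T *m (k *: gram d) = k *: gram d *m mx g.
  by apply: E; rewrite det_mulmx ?dG ?dX ?mulr1 // det_trV.
move: (congr1 (mulmx (mx g)^T) E); rewrite mulKVmx // -scalemxAl -scalemxAr mulmxA.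
by move/(scalerI k0).
Qed.

Lemma tAE : tA = out (1 *: gram 1). Proof. by rewrite gram1 scale1r. Qed.
Lemma det_A : \det (1 *: gram 1 : 'M[F]_3) = 1. Proof. by rewrite gram1 scale1r det1. Qed.

Lemma D_SO (d : F) : t1 \in SO d.
Proof.
apply/SOP; rewrite outer_t1; have [_ ->] := eltP false det_D; split=> //.
by rewrite tr_mx3 !mul_mx3; apply: eq_mx3; ring.
Qed.
Lemma X_SO (d : F) : t2 \in SO d.
Proof.
apply/SOP; rewrite outer_t2; have [_ ->] := eltP false det_X; split=> //.
rewrite tr_mx3 !mul_mx3; apply: eq_mx3; fld.
Qed.
Lemma S_SO : inn S0 \in SO 1.
Proof.
have [o1 o2] := eltP false det_S; apply/SOP; rewrite o1 o2; split=> //.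
by rewrite gram1 mulmx1 trS mulSS.
Qed.
Lemma det_JM : \det (J *m M3) = 1. Proof. by rewrite det_mulmx det_J det_M mulr1. Qed.
Lemma JM_SO : inn (J *m M3) \in SO (-1).
Proof.
have [o1 o2] := eltP false det_JM; apply/SOP; rewrite o1 o2; split=> //.
rewrite -/J trmx_mul trM trJ -!mulmxA (mulmxA J J) mulJJ mul1mx JM (mulmxA M3).
by rewrite mulMMV mul1mx.
Qed.

Lemma t0E : t0 = (tA * inn S0)%g.
Proof. by rewrite /tA (eltMi true det_1 det_S) mul1mx. Qed.
Lemma t3E : t3 = (tB * inn (J *m M3))%g.
Proof. by rewrite /tB (eltMi true det_B det_JM) -scalemxAl mulmxA mulJJ mul1mx. Qed.

Lemma commA g : g \in SO 1 -> commute g tA.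
Proof.
move=> gS; have [og _] := SOP _ _ gS.
by rewrite tAE; apply/(SO_commute (oner_neq0 F) det_A og).
Qed.
Lemma commB g : g \in SO (-1) -> commute g tB.
Proof.
move=> gS; have [og _] := SOP _ _ gS.
by apply/(SO_commute om_neq0 det_B og).
Qed.

Definition p0 : F * F := (- 3%:R^-1, 2%:R * m / 3%:R).
Definition cmul (p p' : F * F) : F * F := (p.1 * p'.1 - p.2 * p'.2, p.1 * p'.2 + p.2 * p'.1).
Definition cpow n : F * F := iter n (cmul p0) (1, 0).

Lemma rotm_mul p p' : rotm p *m rotm p' = rotm (cmul p p').
Proof. by rewrite mul_mx3; apply: eq_mx3; rewrite /=; ring. Qed.

Lemma p0_circle : p0 \in circle F.
Proof. apply/circleP; rewrite /p0 /=; fld. Qed.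

Lemma cmul_circle p p' : p \in circle F -> p' \in circle F -> cmul p p' \in circle F.
Proof.
move=> /circleP pc /circleP pc'; apply/circleP.
transitivity ((p.1 ^+ 2 + p.2 ^+ 2) * (p'.1 ^+ 2 + p'.2 ^+ 2)); first by rewrite /cmul /=; ring.
by rewrite pc pc' mulr1.
Qed.

Lemma one_circle : (1, 0) \in circle F.
Proof. by apply/circleP; rewrite /=; ring. Qed.

Lemma cpow_circle n : cpow n \in circle F.
Proof. by elim: n => [|n IH]; [exact: one_circle | apply: cmul_circle p0_circle IH]. Qed.

Lemma t1t2E : (t1 * t2 = rotation p0)%g.
Proof.
rewrite /t1 (eltMi false det_D det_X) /rotation; congr (elt _ _).
by rewrite mul_mx3; apply: eq_mx3; rewrite /=; ring.
Qed.

Lemma t1t2X n : ((t1 * t2) ^+ n = rotation (cpow n))%g.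
Proof.
elim: n => [|n IH].
  by rewrite expg0 -(elt1 F) /rotation /rotm scalar_mx3 oppr0.
rewrite expgS IH t1t2E /rotation (eltMi false (det_rotm p0_circle) (det_rotm (cpow_circle n))).
by rewrite rotm_mul.
Qed.

(** The conclusion of [rotation_order], which does not mention the quadratic
    extension: a rotation of cosine -1/3 has order q + 1. *)
Hypothesis hrot : forall c s : nat -> F,
  c 0%N = 1 -> s 0%N = 0 -> c 1%N = - 3%:R^-1 -> s 1%N != 0 ->
  (forall n, c n.+2 *+ 3 + c n.+1 *+ 2 + c n *+ 3 = 0) ->
  (forall n, s n.+2 *+ 3 + s n.+1 *+ 2 + s n *+ 3 = 0) ->
  forall k, (#|F|.+1 %| k)%N <-> (c k = 1 /\ s k = 0).

(** Both coordinates of the powers of the rotation satisfy the recurrence of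
    3 X^2 + 2 X + 3, to which [hrot] applies. *)
Lemma order_t1t2 : #[(t1 * t2)%g] = #|F|.+1.
Proof.
have m0 : m != 0 by apply: contra_eq_neq hm => ->; rewrite expr0n eq_sym.
have c1 : (cpow 1).1 = - 3%:R^-1 by rewrite /cpow /cmul /=; ring.
have s1 : (cpow 1).2 != 0.
  have -> : (cpow 1).2 = 2%:R * m / 3%:R by rewrite /cpow /cmul /=; ring.
  by rewrite !mulf_neq0 ?invr_eq0.
have cS n : cpow n.+1 = cmul p0 (cpow n) by [].
have rc n : (cpow n.+2).1 *+ 3 + (cpow n.+1).1 *+ 2 + (cpow n).1 *+ 3 = 0.
  rewrite !cS; move: (cpow n) => [c s]; rewrite /cmul /=; fld.
have rs n : (cpow n.+2).2 *+ 3 + (cpow n.+1).2 *+ 2 + (cpow n).2 *+ 3 = 0.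
  rewrite !cS; move: (cpow n) => [c s]; rewrite /cmul /=; fld.
have H k : (#|F|.+1 %| k)%N <-> ((t1 * t2) ^+ k = 1)%g.
  rewrite (@hrot (fun n => (cpow n).1) (fun n => (cpow n).2) erefl erefl c1 s1 rc rs k) t1t2X.
  split=> [[e1 e2]|E].
    by rewrite (surjective_pairing (cpow k)) e1 e2 -(t1t2X 0).
  have /rotm_inj -> : rotm (cpow k) = rotm (cpow 0).
    by rewrite -!mx_rot ?cpow_circle // E -(t1t2X 0).
  by [].
apply/eqP; rewrite eqn_dvd order_dvdn; apply/andP; split; first by apply/eqP/H.
by apply/H; apply: expg_order.
Qed.

Lemma card_circle : #|circle F| = #|F|.+1.
Proof.
apply/eqP; rewrite eqn_leq card_circle_le // -order_t1t2 orderE.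
apply: leq_trans (leq_imset_card (@rotation F) (circle F)).
apply: subset_leq_card; apply/subsetP=> _ /cycleP[n ->]; rewrite t1t2X.
exact: imset_f (cpow_circle n).
Qed.

(** The q + 1 powers of t1 t2 are rotations, and there are no more. *)
Lemma rotation_cycle p : p \in circle F -> rotation p \in <[(t1 * t2)%g]>.
Proof.
have -> : <[(t1 * t2)%g]> = @rotation F @: circle F.
  apply/eqP; rewrite eqEcard -orderE order_t1t2 -card_circle leq_imset_card andbT.
  apply/subsetP=> _ /cycleP[n ->]; rewrite t1t2X; exact: imset_f (cpow_circle n).
exact: imset_f.
Qed.

Local Notation G a b c d := (gens t0 t1 t2 t3 a b c d).
Local Notation G123 := (G true true true false).
Local Notation G234 := (G false true true true).
Local Notation G23 := (G false true true false).

Lemma gen_in : [/\ t0 \in G123, t1 \in G23, t2 \in G23 & t3 \in G234].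
Proof.
have [h0 _ _ _] := mem_gens t0 t1 t2 t3 true true true false.
have [_ h1 h2 _] := mem_gens t0 t1 t2 t3 false true true false.
have [_ _ _ h3] := mem_gens t0 t1 t2 t3 false true true true.
by split; [exact: h0 | exact: h1 | exact: h2 | exact: h3].
Qed.

Lemma G23_sub : G23 \subset G123 /\ G23 \subset G234.
Proof. by split; apply: gensS. Qed.

Lemma rotation_G23 p : p \in circle F -> rotation p \in G23.
Proof.
have [_ h1 h2 _] := gen_in.
by move/rotation_cycle; apply: subsetP; rewrite cycle_subG groupM.
Qed.

Lemma G23_SO d : G23 \subset SO d.
Proof. by apply: gens_subG => // _; [exact: D_SO | exact: X_SO]. Qed.

Lemma G123_cent : G123 \subset 'C[tA].
Proof.
have cx x : x \in SO 1 -> x \in 'C[tA] by move/commA/cent1P.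
apply: gens_subG => // _.
- by rewrite t0E groupM ?cent1id // cx // S_SO.
- exact/cx/D_SO.
- exact/cx/X_SO.
Qed.

Lemma G234_cent : G234 \subset 'C[tB].
Proof.
have cx x : x \in SO (-1) -> x \in 'C[tB] by move/commB/cent1P.
apply: gens_subG => // _.
- exact/cx/D_SO.
- exact/cx/X_SO.
- by rewrite t3E groupM ?cent1id // cx // JM_SO.
Qed.

(** The half sum of the two forms is z^2, so an isometry of both preserves the
    z-coordinate up to sign; the image of the pole has norm 1 for both forms, so
    its first two coordinates form an isotropic vector of the plane. *)
Lemma SO_both (g : gT) : g \in SO 1 -> g \in SO (-1) ->
  (mx g o2 o2 = 1 \/ mx g o2 o2 = -1) /\ (mx g o0 o2 = 0 /\ mx g o1 o2 = 0).
Proof.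
case/SOP=> og E1 /SOP[_ E2]; move: E1 E2.
have [a [b [c [d [e [f [p [q [r ->]]]]]]]]] := mx3P (mx g).
rewrite tr_mx3 !mul_mx3 => /mx3_inj[_ _ [_ _ E1]] /mx3_inj[_ _ [_ _ E2]].
rewrite !mxE /=.
have {}E1 : c ^+ 2 + f ^+ 2 + r ^+ 2 = 1 by rewrite -[RHS]E1; ring.
have {}E2 : r ^+ 2 - c ^+ 2 - f ^+ 2 = 1 by rewrite -[RHS]E2; ring.
have r1 : r ^+ 2 = 1.
  apply: (mulfI n2); transitivity ((c ^+ 2 + f ^+ 2 + r ^+ 2) + (r ^+ 2 - c ^+ 2 - f ^+ 2)).
    by ring.
  by rewrite E1 E2; ring.
have [c0 f0] : c = 0 /\ f = 0.
  by apply: (sum_sq_eq0 nm1); apply: (addIr (r ^+ 2)); rewrite E1 add0r r1.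
split=> //; move/eqP: r1; rewrite sqrf_eq1 => /orP[]/eqP; by [left | right].
Qed.

Lemma SO_both_G23 (g : gT) : g \in SO 1 -> g \in SO (-1) -> g \in G23.
Proof.
move=> g1 gm; have [_ h1 h2 _] := gen_in.
have n10 := oner_neq0 F.
have [[r1|r1] [c0 f0]] := SO_both g1 gm.
  have [|p pc ->] := SO_fix_pole n10 g1; last exact: rotation_G23.
  by congr (_, (_, _)); [exact: r1 | exact: c0 | exact: f0].
suff : (t1 * g)%g \in G23 by rewrite groupMl.
have hS : (t1 * g)%g \in SO 1 by rewrite groupM ?D_SO.
have [|p pc ->] := SO_fix_pole n10 hS; last exact: rotation_G23.
rewrite /pole_col; have [og _] := SOP _ _ g1.
have [_ m1] := eltP false det_D.
rewrite !mxM og m1; move: r1 c0 f0.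
have [a [b [c [d [e [f [p [q [r ->]]]]]]]]] := mx3P (mx g).
rewrite mul_mx3 !mxE /= => -> -> ->; congr (_, (_, _)); ring.
Qed.

(** An outer element would conjugate the matrix om J of tA tB to its inverse
    transpose om^2 J; but no nonzero X satisfies X (om J) = (om^2 J) X. *)
Lemma cap_inner (g : gT) : commute g tA -> commute g tB -> outer g = false.
Proof.
move=> cA cB; apply/negbTE/negP => og.
have E : (tA * tB = inn (om *: J))%g.
  by rewrite (out_mul true det_1 det_B (A' := 1%:M)) ?trmx1 ?mul1mx.
have [oB mB] := eltP false det_B.
have c : (g * inn (om *: J) = inn (om *: J) * g)%g.
  by rewrite -E mulgA cA -mulgA cB mulgA.
have := congr1 (@mx F) c; rewrite !mxM oB og mB.
have -> : invmx (om *: J)^T = om ^+ 2 *: J.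
  by rewrite -[RHS]mul1mx -(mulVmx (_ : (om *: J)^T \in unitmx)) -?mulmxA ?trBV ?mulmx1 // unitmx_tr -mB mx_unit.
have := det_mx g.
have [a [b [c' [d [e [f [p [q [r ->]]]]]]]]] := mx3P (mx g) => dg.
rewrite !scale_mx3 !mul_mx3 => /mx3_inj[[Ea Eb Ec] _ _].
have omne : om * (om - 1) != 0.
  rewrite mulf_neq0 ?om_neq0 // subr_eq0; apply: contra om2_neq1 => /eqP->.
  by rewrite expr1n.
have ompe : om * (om + 1) != 0.
  rewrite mulf_neq0 ?om_neq0 // addr_eq0; apply/negP=> /eqP om1.
  by have := om2_neq1; rewrite om1 sqrrN expr1n eqxx.
have a0 : a = 0.
  apply: (mulfI omne); rewrite mulr0.
  have -> : om * (om - 1) * a = a * (om * -1) - om ^+ 2 * -1 * a by ring.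
  move: Ea; rewrite !mulr0 !mul0r !addr0 => ->; ring.
have b0 : b = 0.
  apply: (mulfI omne); rewrite mulr0.
  have -> : om * (om - 1) * b = b * (om * -1) - om ^+ 2 * -1 * b by ring.
  move: Eb; rewrite !mulr0 !mul0r !addr0 ?add0r => ->; ring.
have c0 : c' = 0.
  apply: (mulfI ompe); rewrite mulr0.
  have -> : om * (om + 1) * c' = c' * (om * 1) - om ^+ 2 * -1 * c' by ring.
  move: Ec; rewrite !mulr0 !mul0r !addr0 ?add0r => ->; ring.
by move/eqP: dg; rewrite det_mx3 a0 b0 c0 !mul0r subr0 addr0 eq_sym oner_eq0.
Qed.

Lemma cap_G123_G234 : G123 :&: G234 \subset G23.
Proof.
apply/subsetP=> g /setIP[/(subsetP G123_cent)/cent1P cA /(subsetP G234_cent)/cent1P cB].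
have og := cap_inner cA cB.
apply: SO_both_G23.
  by apply/(SO_commute (oner_neq0 F) det_A og); rewrite -tAE.
by apply/(SO_commute om_neq0 det_B og).
Qed.
Lemma det_MV : \det M3V = 1.
Proof. by rewrite -[LHS]mul1r -[X in X * _]det_M -det_mulmx mulMMV det1. Qed.
Lemma det_SD : \det (S0 *m D1) = 1. Proof. by rewrite det_mulmx det_S det_D mulr1. Qed.
Lemma det_XW : \det (X2 *m W) = 1. Proof. by rewrite det_mulmx det_X det_W mulr1. Qed.
Lemma trSD : (S0 *m D1)^T *m (S0 *m D1) = 1%:M.
Proof. by rewrite trmx_mul trS trD -mulmxA (mulmxA S0) mulSS mul1mx mulDD. Qed.
Lemma trXW : (X2 *m W)^T *m (X2 *m (om ^+ 2 *: M3V)) = 1%:M.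
Proof. by rewrite trmx_mul trX -mulmxA (mulmxA X2) mulXX mul1mx trWV. Qed.
Lemma scale_VM A : om ^+ 2 *: M3V *m (A *m W) = M3V *m (A *m M3).
Proof.
by rewrite /W -!scalemxAr -scalemxAl scalerA mulrC -exprSr om3 scale1r.
Qed.

Lemma t0t1E : (t0 * t1)%g = out (S0 *m D1).
Proof. exact: eltMi det_S det_D. Qed.
Lemma t2t3E : (t2 * t3)%g = out (X2 *m W).
Proof. exact: (out_mul false det_X det_W trXX). Qed.
Lemma t1Jt0 : (t1 ^ t0)%g = inn (S0 *m D1 *m S0).
Proof.
have t0V : (t0^-1 = t0)%g by apply/eqP; rewrite eq_invg_mul -expg2 t0_sqr.
by rewrite conjgE t0V mulgA t0t1E (out_mul true det_SD det_S trSD).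
Qed.
Lemma t2Jt3 : (t2 ^ t3)%g = inn (M3V *m (X2 *m M3)).
Proof.
have t3V : (t3^-1 = t3)%g by apply/eqP; rewrite eq_invg_mul -expg2 t3_sqr.
by rewrite conjgE t3V t2t3E (out_mul true det_W det_XW trWV) scale_VM.
Qed.

Lemma m_neq0 : m != 0. Proof. by apply: contra_eq_neq hm => ->; rewrite expr0n eq_sym. Qed.
Lemma al_neq0 : al != 0.
Proof. by apply: contra_eq_neq hal => ->; rewrite expr0n eq_sym oppr_eq0. Qed.

Lemma order_t0t1 : #[(t0 * t1)%g] = 4%N.
Proof.
have E : ((t0 * t1) ^+ 2 = inn (S0 *m D1 *m (S0 *m D1)))%g.
  by rewrite expg2 t0t1E (out_mul true det_SD det_SD trSD).
have dE : \det (S0 *m D1 *m (S0 *m D1)) = 1 by rewrite det_mulmx det_SD mulr1.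
apply: order4.
  rewrite (expgM _ 2 2) E expg2 (eltMi false dE dE) -(elt1 F); congr (elt _ _).
  rewrite !mul_mx3 scalar_mx3; apply: eq_mx3; fld.
apply/eqP; rewrite E -(elt1 F) => /(elt_inj dE det_1).
rewrite !mul_mx3 scalar_mx3 => /mx3_inj[_ [_ _ E12] _].
have /eqP[] := oner_neq0 F; rewrite -[RHS]oppr0 -E12; fld.
Qed.

Lemma order_t2t3 : #[(t2 * t3)%g] = 4%N.
Proof.
have E : ((t2 * t3) ^+ 2 = inn (X2 *m (M3V *m (X2 *m M3))))%g.
  by rewrite expg2 t2t3E (out_mul true det_XW det_XW trXW) /= -mulmxA scale_VM.
have dE : \det (X2 *m (M3V *m (X2 *m M3))) = 1.
  by rewrite !det_mulmx det_X det_MV det_M !mulr1.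
apply: order4.
  rewrite (expgM _ 2 2) E expg2 (eltMi false dE dE) -(elt1 F); congr (elt _ _).
  rewrite !mul_mx3 scalar_mx3; apply: eq_mx3; fld.
apply/eqP; rewrite E -(elt1 F) => /(elt_inj dE det_1).
rewrite !mul_mx3 scalar_mx3 => /mx3_inj[_ _ [E20 _ _]].
have /eqP[] : al * m / 3%:R != 0 by rewrite !mulf_neq0 ?invr_eq0 ?al_neq0 ?m_neq0.
rewrite -[RHS]E20; fld.
Qed.

Lemma inner_group_set : group_set [set g : gT | ~~ outer g].
Proof.
apply/group_setP; split=> [|g h]; first by rewrite inE outer1.
by rewrite !inE outerM => /negbTE-> /negbTE->.
Qed.
Definition innerG : {group gT} := Group inner_group_set.

Lemma innerP g : g \in innerG = ~~ outer g. Proof. by rewrite inE. Qed.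

Lemma G23_inner : G23 \subset innerG.
Proof.
by apply/subsetP=> g /(subsetP (G23_SO 1))/SOP[og _]; rewrite innerP og.
Qed.

Lemma G23_pole g : g \in G23 -> mx g o0 o2 = 0 /\ mx g o1 o2 = 0.
Proof. by move=> gG; have [] := SO_both (subsetP (G23_SO 1) _ gG) (subsetP (G23_SO (-1)) _ gG). Qed.

(** [t1 ^ t0] moves the pole off its axis, unlike the elements of <t1, t2>. *)
Lemma cap_G12_G23 : G true true false false :&: G23 \subset <[t1]>.
Proof.
have [_ h1 _ _] := gen_in.
have dE : \det (S0 *m D1 *m S0) = 1 by rewrite det_mulmx det_SD det_S mulr1.
have [oE mE] := eltP false dE.
apply: (@dihedral8_cap _ t0 t1 innerG _ t0_sqr t1_sqr _ _ _ _ G23_inner h1).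
- by rewrite -order_t0t1 expg_order.
- by rewrite innerP outer_t0.
- by rewrite innerP outer_t1.
- by rewrite innerP t1Jt0 oE.
apply/negP=> /G23_pole[_]; rewrite t1Jt0 mE !mul_mx3 mxE /= => E12.
have /eqP[] := oner_neq0 F; rewrite -[RHS]E12; fld.
Qed.

Lemma cap_G34_G23 : G false false true true :&: G23 \subset <[t2]>.
Proof.
have [_ _ h2 _] := gen_in.
have dE : \det (M3V *m (X2 *m M3)) = 1.
  by rewrite !det_mulmx det_X det_MV det_M !mulr1.
have [oE mE] := eltP false dE.
rewrite gens_last2.
apply: (@dihedral8_cap _ t3 t2 innerG _ t3_sqr t2_sqr _ _ _ _ G23_inner h2).
- have -> : (t3 * t2 = (t2 * t3) ^ t2)%g by rewrite conjgE -!mulgA mulKg.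
  by rewrite -conjXg -order_t2t3 expg_order conj1g.
- by rewrite innerP outer_t3.
- by rewrite innerP outer_t2.
- by rewrite innerP t2Jt3 oE.
apply/negP=> /G23_pole[E02 _]; move: E02; rewrite t2Jt3 mE !mul_mx3 mxE /= => E02.
have /eqP[] : al * m / 3%:R != 0 by rewrite !mulf_neq0 ?invr_eq0 ?al_neq0 ?m_neq0.
rewrite -[RHS]E02; fld.
Qed.

(** tA commutes with the rotations, so conjugating them by t0 amounts to
    conjugating them by the isometry S0, which takes the pole to height -1/2. *)
Lemma SO_sub_G123 : SO 1 \subset G123.
Proof.
have [h0 _ _ _] := gen_in; have [s1 _] := G23_sub.
have [oS mS] := eltP false det_S.
apply: (SO_gen nm1 n2 n3 (oner_neq0 F) S_SO _ card_circle).
- by rewrite mS mxE.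
- by move=> p pc; apply: (subsetP s1); apply: rotation_G23.
move=> p pc; have cp := commA (rotation_SO 1 pc).
have -> : (rotation p ^ inn S0 = rotation p ^ t0)%g.
  by rewrite t0E conjgM; congr (_ ^ _)%g; rewrite conjgE cp mulKg.
by apply: groupJ; [exact: (subsetP s1 _ (rotation_G23 pc)) | exact: h0].
Qed.

(** As for [SO_sub_G123], with tB and J M3. *)
Lemma SO_sub_G234 : SO (-1) \subset G234.
Proof.
have [_ _ _ h3] := gen_in; have [_ s1] := G23_sub.
have [oS mS] := eltP false det_JM.
have nN1 : (-1 : F) != 0 by rewrite oppr_eq0 oner_neq0.
apply: (SO_gen nm1 n2 n3 nN1 JM_SO _ card_circle).
- by rewrite mS mul_mx3 mxE /=; ring.
- by move=> p pc; apply: (subsetP s1); apply: rotation_G23.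
move=> p pc; have cp := commB (rotation_SO (-1) pc).
have -> : (rotation p ^ inn (J *m M3) = rotation p ^ t3)%g.
  by rewrite t3E conjgM; congr (_ ^ _)%g; rewrite conjgE cp mulKg.
by apply: groupJ; [exact: (subsetP s1 _ (rotation_G23 pc)) | exact: h3].
Qed.

Lemma tA_in : tA \in G123.
Proof.
have [h0 _ _ _] := gen_in.
by rewrite -(groupMr _ (subsetP SO_sub_G123 _ S_SO)) -t0E.
Qed.
Lemma tB_in : tB \in G234.
Proof.
have [_ _ _ h3] := gen_in.
by rewrite -(groupMr _ (subsetP SO_sub_G234 _ JM_SO)) -t3E.
Qed.

Lemma gens_all : [set: gT] = G true true true true.
Proof.
have [h0 _ _ _] := gen_in.
have s3 : G123 \subset G true true true true by apply: gensS.
have s0 : G234 \subset G true true true true by apply: gensS.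
have inH g : outer g = false -> g \in G true true true true.
  apply: (SO_gen_SL nm1 n2 n3).
    exact: subset_trans SO_sub_G123 s3.
  exact: subset_trans SO_sub_G234 s0.
apply/esym/eqP; rewrite eqEsubset subsetT; apply/subsetP=> g _.
case og: (outer g); last exact: inH.
by rewrite -(groupMr _ (subsetP s3 _ h0)); apply: inH; rewrite outerM og outer_t0.
Qed.
Definition ts : 4.-tuple gT := [tuple t0; t1; t2; t3].

Lemma outer_neq1 (g : gT) : outer g -> g != 1%g.
Proof. by apply: contraL => /eqP->; rewrite outer1. Qed.

Lemma t1_neq1 : t1 != 1%g.
Proof.
apply/eqP; rewrite -(elt1 F) => /(elt_inj det_D det_1).
rewrite scalar_mx3 => /mx3_inj[_ [_ E _] _].
by have /eqP[] := n2; rewrite -(subrr (1 : F)) -[X in _ - X]E; ring.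
Qed.

Lemma t2_neq1 : t2 != 1%g.
Proof.
apply/eqP; rewrite -(elt1 F) => /(elt_inj det_X det_1).
rewrite scalar_mx3 => /mx3_inj[_ _ [_ _ E]].
by have /eqP[] := n2; rewrite -(subrr (1 : F)) -[X in _ - X]E; ring.
Qed.

Lemma t1_neq2 : t1 != t2.
Proof.
apply/eqP=> /(elt_inj det_D det_X) /mx3_inj[[_ E _] _ _].
have /eqP[] : 2%:R * m / 3%:R != 0 by rewrite !mulf_neq0 ?invr_eq0 ?m_neq0.
exact: esym E.
Qed.

Lemma Cstring_ts : Cstring [set: gT] ts.
Proof.
have o0' : outer t0 by exact: outer_t0.
have o3' : outer t3 by exact: outer_t3.
have hi g : outer g -> g \notin G23.
  by move=> og; apply/negP=> /(subsetP G23_inner); rewrite innerP og.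
apply: (Cstring4 t0_sqr t3_sqr c02 c03 c13 cap_G123_G234 cap_G12_G23 cap_G34_G23
  t1_sqr t2_sqr (hi _ o0') (hi _ o3') t1_neq2 (outer_neq1 o0') t1_neq1 t2_neq1 (outer_neq1 o3')).
exact: gens_all.
Qed.

Lemma schlafli_ts : schlafli ts = [:: 4; #|F|.+1; 4]%N.
Proof. by rewrite schlafli4 order_t0t1 order_t1t2 order_t2t3. Qed.

Section Quotient.
Variable N : {group gT}.
Hypothesis nN : N <| [set: gT].

Lemma norm_all : [set: gT] \subset 'N(N). Proof. exact: normal_norm. Qed.

(** Modulo N the outer involution tA equals tB times the half turn J about the
    pole, so its image lies in the images of both maximal parabolic subgroups; it
    is not in the image of <t1, t2>, because N and <t1, t2> are inner. *)
Lemma quotient_not_Cstring : (forall g, g \in N -> outer g = false) -> inn om%:M \in N ->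
  ~ Cstring ([set: gT] / N)%g (map_tuple (coset N) ts).
Proof.
move=> iN zN [_ _ _ IP].
have := IP [set i : 'I_4 | nth false [:: true; true; true; false] i]
           [set i : 'I_4 | nth false [:: false; true; true; true] i].
have -> : [set i : 'I_4 | nth false [:: true; true; true; false] i] :&:
          [set i : 'I_4 | nth false [:: false; true; true; true] i] =
          [set i : 'I_4 | nth false [:: false; true; true; false] i].
  by apply/setP=> -[[|[|[|[|//]]]] hi]; rewrite !inE.
rewrite !(subgen_coset _ _ norm_all) !subgen_bits => IPN.
have nNx g : g \in 'N(N) by apply: (subsetP norm_all); rewrite inE.
have jc : (-1, 0) \in circle F by apply/circleP; rewrite /=; ring.
have dz : \det (om%:M : 'M[F]_3) = 1 by rewrite det_scalar om3.
have jE : (tA * inn om%:M)%g = (tB * rotation ((-1, 0) : F * F))%g.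
  rewrite /tA (eltMi true det_1 dz) /tB /rotation (eltMi true det_B (det_rotm jc)).
  congr (elt _ _); rewrite mul1mx scalar_mx3 /J /gram /rotm scale_mx3 mul_mx3 /=.
  by apply: eq_mx3; ring.
have cA : coset N tA = coset N (tB * rotation ((-1, 0) : F * F))%g.
  by rewrite -jE morphM ?nNx //= (coset_id zN) mulg1.
have [_ s2] := G23_sub.
have : coset N tA \in (G23 / N)%g.
  rewrite -IPN; apply/setIP; split; first exact: mem_quotient tA_in.
  rewrite cA; apply: mem_quotient; apply: groupM; first exact: tB_in.
  exact: (subsetP s2 _ (rotation_G23 jc)).
case/morphimP=> g _ gG23 E.
have : (tA * g^-1)%g \in N.
  by apply: coset_idr; rewrite ?nNx // morphM ?morphV ?nNx //= E mulgV.
have := G23_inner; move=> /subsetP/(_ g gG23); rewrite innerP => og.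
by move=> /iN h; have := outerM (tA * g^-1)%g g; rewrite mulgKV outer_tA h (negbTE og).

Qed.

Lemma center_scalar (k : F) : k ^+ 3 = 1 -> k != 1 -> k = om \/ k = om ^+ 2.
Proof.
move=> k3 k1; have : (k - 1) * ((k - om) * (k - om ^+ 2)) = 0.
  have -> : (k - 1) * ((k - om) * (k - om ^+ 2)) =
            k ^+ 3 - (1 + om + om ^+ 2) * (k ^+ 2) + (om + om ^+ 2 + om ^+ 3) * k - om ^+ 3 by ring.
  have s0 : 1 + om + om ^+ 2 = 0 by rewrite /om; fld.
  have -> : om + om ^+ 2 + om ^+ 3 = 0 by rewrite om3 -[RHS]s0; ring.
  by rewrite k3 om3 s0 !mul0r subr0 addr0 subrr.
by move/eqP; rewrite !mulf_eq0 !subr_eq0 (negPf k1) /= => /orP[]/eqP; [left | right].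
Qed.

(** If all the matrices in N are scalar then N contains the scalar om, and
    [quotient_not_Cstring] applies; otherwise t1 and t2 have trivial images. *)
Lemma N_unravelled_ts : N :!=: 1%g -> N_unravelled [set: gT]%G N ts.
Proof.
move=> N1; have nNJ g h : g \in N -> (g ^ h)%g \in N.
  by move=> gN; rewrite memJ_norm // (subsetP norm_all) // inE.
case: (boolP [forall g in N, outer g || [exists k, mx g == k%:M]]) => [/forall_inP Hs|].
  have sc g : g \in N -> outer g = false -> exists k, mx g = k%:M.
    by move=> gN og; have := Hs g gN; rewrite og => /existsP[k /eqP]; exists k.
  have iN := normal_scalar_inner nNJ sc.
  have zN : inn om%:M \in N.
    have [g gN g1] := trivgPn _ N1.
    have [k gk] := sc g gN (iN g gN).
    have gE : g = inn k%:M by rewrite -gk -(iN g gN) eltK.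
    have k3 : k ^+ 3 = 1 by rewrite -[LHS](det_scalar 3 k) -gk det_mx.
    have k1 : k != 1 by apply: contra g1 => /eqP k1; rewrite gE k1 elt1.
    have dk : \det (k%:M : 'M[F]_3) = 1 by rewrite -gk det_mx.
    case: (center_scalar k3 k1) => kE; first by rewrite -kE -gE.
    have -> : inn om%:M = (g * g)%g.
      rewrite gE (eltMi false dk dk) -scalar_mxM kE; congr (elt _ _%:M).
      by rewrite -exprD (exprD _ 3 1) om3 mul1r.
    by rewrite groupM.
  have le4 : (#|[set x in map_tuple (coset N) ts]| <= 4)%N.
    by rewrite cardsE; apply: leq_trans (card_size _) _; rewrite size_tuple.
  move: le4; rewrite leq_eqVlt => /orP[/eqP c4|c4]; [right | by left].
  by split=> //; apply: quotient_not_Cstring.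
case/forall_inPn=> g gN; rewrite negb_or => /andP[og /existsPn ns]; left.
have inN : forall h, outer h = false -> h \in N.
  by apply: (normal_nonscalar_SL nNJ); exists g => //; split; [exact: negbTE | exact: ns].
have c1 : coset N t1 = 1%g by apply: coset_id; apply: inN outer_t1.
have c2 : coset N t2 = 1%g by apply: coset_id; apply: inN outer_t2.
have : [set x in map_tuple (coset N) ts] \subset [set coset N t0; 1%g; coset N t3].
  by apply/subsetP=> x; rewrite !inE /= c1 c2; move=> /or4P[]->; rewrite ?orbT.
move/subset_leq_card => le; apply: leq_ltn_trans le _.
apply: leq_ltn_trans (_ : (3 < 4)%N) => //.
rewrite (leq_trans (leq_card_setU _ _)) // cards1 addn1 ltnS.
by rewrite (leq_trans (leq_card_setU _ _)) // !cards1.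
Qed.

End Quotient.

Lemma unravelled_ts : unravelled [set: gT]%G ts.
Proof. by move=> N nN N1 _; apply: N_unravelled_ts. Qed.

End Main.

Theorem theorem1p2 (q : nat) (F L : finFieldType)
    (hF : #|F| = q) (hL : #|L| = (q ^ 2)%N)
    (hq : (6 %| q - 1)%N)
    (hlm : exists lambda mu : F,
       (2%:R * lambda ^+ 2 = 1 /\ 2%:R * mu ^+ 2 - lambda ^+ 2 = 0)%R)
    (r : L) (hr : (r ^+ 2 = 3%:R ^- 2 - 1)%R)
    (hord : (q.+1.-primitive_root (- 3%:R^-1 + r))%R \/
            (q.+1.-primitive_root (- 3%:R^-1 - r))%R) :
  exists t : 4.-tuple (SL_trinv_sdprod 3 F),
    [/\ Cstring [set: SL_trinv_sdprod 3 F] t,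
        unravelled [set: SL_trinv_sdprod 3 F]%G t
      & schlafli t = [:: 4; q.+1; 4]%N].
Proof.
have [l [_ [hl _]]] := hlm.
have n2 := two_neq0 hF hq; have n3 := three_neq0 hF hq.
have nm1 := m1_nonsquare hF hq hL hl hr hord.
have [al hal] := sqrt_m3 hF hq.
have hm : ((2%:R * l) ^+ 2 = 2%:R)%R by rewrite exprMn expr2 -mulrA hl mulr1.
rewrite -{q}hF in hL hq hord *.
have hrot := rotation_order erefl hq hL hr hord.
exists (ts (2%:R * l)%R al); split.
- exact: (Cstring_ts nm1 n2 n3 hm hal hrot).
- exact: (unravelled_ts nm1 n2 n3 hm hal hrot).
- by rewrite (schlafli_ts n2 n3 hm hal hrot).
Qed.
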